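(* If $G$ is a $(P_6,C_4,C_6)$-free graph with $\Delta(G)\geq 9$ and $\omega(G)\leq \Delta(G)-1$, then $\chi(G)\leq \Delta(G)-1$.
   Context: All graphs are finite, simple and undirected. $\Delta(G)$, $\omega(G)$, $\chi(G)$ denote the maximum degree, clique number and chromatic number of $G$. $P_n$ and $C_n$ denote the chordless path and chordless cycle on $n$ vertices. A graph is $(H_1,\dots,H_n)$-free if no induced subgraph of it is isomorphic to any $H_i$. *)

(* Defs.v *)
From Stdlib Require List.
From mathcomp Require Import all_boot.

Set Implicit Arguments.
Unset Strict Implicit.
Unset Printing Implicit Defensive.

Record sgraph := SGraph {
  vertex :> finType;
  adj : rel vertex;
  adj_sym : symmetric adj;
  adj_irrefl : irreflexive adj
}.
Arguments adj {s} x y.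

Section Invariants.
Variable G : sgraph.

Definition degree (x : G) : nat := #|[set y | adj x y]|.

Definition max_degree : nat := \max_(x : G) degree x.

Definition clique (A : {set G}) : bool :=
  [forall x in A, forall y in A, (x != y) ==> adj x y].

Definition clique_number : nat := \max_(A : {set G} | clique A) #|A|.

Definition proper_coloring (k : nat) (c : {ffun G -> 'I_k}) : bool :=
  [forall x, forall y, adj x y ==> (c x != c y)].

Definition colorable (k : nat) : bool :=
  [exists c : {ffun G -> 'I_k}, proper_coloring c].

Lemma colorable_exists : exists k, colorable k.
Proof.
exists #|G|; apply/existsP; exists [ffun x => enum_rank x].
apply/forallP=> x; apply/forallP=> y; apply/implyP=> xy; rewrite !ffunE.
apply: contraTneq xy => /enum_rank_inj ->.
by rewrite adj_irrefl.
Qed.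

Definition chromatic_number : nat := ex_minn colorable_exists.

End Invariants.

Section Induced.
Variables (G : sgraph) (A : {set G}).

Definition induced_adj : rel {x : G | x \in A} :=
  fun u v => adj (val u) (val v).

Lemma induced_adj_sym : symmetric induced_adj.
Proof. by move=> u v; apply: adj_sym. Qed.

Lemma induced_adj_irrefl : irreflexive induced_adj.
Proof. by move=> u; apply: adj_irrefl. Qed.

Definition induced : sgraph := SGraph induced_adj_sym induced_adj_irrefl.

End Induced.

Definition isomorphic (G H : sgraph) : Prop :=
  exists2 f : G -> H, bijective f & forall x y, adj (f x) (f y) = adj x y.

Definition free (Hs : seq sgraph) (G : sgraph) : Prop :=
  forall H, List.In H Hs -> forall A : {set G}, ~ isomorphic (induced A) H.

Section PathCycle.
Variable n : nat.

Definition path_adj : rel 'I_n := fun i j => (i.+1 == j) || (j.+1 == i).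

Lemma path_adj_sym : symmetric path_adj.
Proof. by move=> i j; apply: orbC. Qed.

Lemma path_adj_irrefl : irreflexive path_adj.
Proof. by move=> i; rewrite /path_adj orbb gtn_eqF. Qed.

Definition path_graph : sgraph := SGraph path_adj_sym path_adj_irrefl.

(* For n < 3 this is not a cycle: the condition i != j only removes the loop
   that n = 1 would produce. *)
Definition cycle_adj : rel 'I_n :=
  fun i j => (i != j) && ((i.+1 %% n == j) || (j.+1 %% n == i)).

Lemma cycle_adj_sym : symmetric cycle_adj.
Proof. by move=> i j; rewrite /cycle_adj eq_sym orbC. Qed.

Lemma cycle_adj_irrefl : irreflexive cycle_adj.
Proof. by move=> i; rewrite /cycle_adj eqxx. Qed.

Definition cycle_graph : sgraph := SGraph cycle_adj_sym cycle_adj_irrefl.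

End PathCycle.

(* Main.v *)
Require Import Defs.
From mathcomp Require Import all_boot.
From mathcomp Require Import zify.

(* Let [k] be the maximum degree minus one. A minimal induced subgraph that is not
   [k]-colourable has no clique cutset. Its holes are five-cycles, every five-cycle
   dominates it, and a vertex not complete to a five-cycle [C] is attached to one,
   two or three consecutive vertices of [C].

   Suppose it contains a pyramid: an apex [a] joined by three paths of length two
   to a triangle. The nonneighbours of [a] are then complete to the triangle. Since
   [a] has degree at most [k + 1], its closed neighbourhood can be coloured with
   the three neighbours of [a] in the pyramid sharing a colour, and Hall's theorem
   extends the colouring, unless the nonneighbours of [a] form a clique of order
   exactly [k]; a second colouring, by two pairs of equally coloured vertices, then
   succeeds because [k >= 8].

   Without pyramids, a five-cycle whose ring of blown-up vertices is largest has no
   vertex attached to only one or two of its vertices: a component of these would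
   have a clique as boundary. So the graph is a ring plus universal vertices. A
   universal vertex leaves at most [k + 2] vertices, two of which can be saved on
   the five-cycle. In a ring of parts of sizes [a_i], the degree bound gives
   [a_(i-1) + a_i + a_(i+1) <= k + 2], hence at most [2k] vertices as [k >= 8], and
   an explicit colouring exists. *)

Set Implicit Arguments.
Unset Strict Implicit.
Unset Printing Implicit Defensive.

(** * Closed adjacency and forbidden subgraphs *)

(** A closed neighbourhood may have [k + 2] vertices, so colouring it with [k] colours may have to
    save two: by one triple or by two pairs of nonadjacent vertices sharing a colour. The three
    neighbours of the apex in a pyramid form such a triple. A nonneighbour of the apex sees at most
    one of them, as it would otherwise close a four-cycle; these legs therefore split the
    nonneighbours into classes.

    The bound [k >= 8] comes from two counts. Three such classes turn out to cover at most [6 + 1]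
    vertices, although they must cover [k]. In a ring of [n] vertices the five degree bounds add up
    to [3 * n <= 5 * (k + 2)]; with rounding this gives [n <= 2 * k] from [k = 8] on, but not for
    [k = 7]. *)

Section ClosedAdjacency.
Variable G : sgraph.
Implicit Types (x y z : G) (A : {set G}).

Definition nb x y := (x == y) || adj x y.

Definition nb_clique A := {in A &, forall x y, nb x y}.

Lemma nb_refl x : nb x x.
Proof. by rewrite /nb eqxx. Qed.

Lemma nb_sym : symmetric nb.
Proof. by move=> x y; rewrite /nb eq_sym adj_sym. Qed.

Lemma adj_nb x y : adj x y -> nb x y.
Proof. by rewrite /nb => ->; rewrite orbT. Qed.

Lemma nb_false_adj x y : nb x y = false -> adj x y = false.
Proof. by rewrite /nb => /norP[_ /negbTE]. Qed.

Lemma nb_false_neq x y : nb x y = false -> x != y.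
Proof. by rewrite /nb => /norP[]. Qed.

Lemma adjE x y : adj x y = nb x y && (x != y).
Proof.
by rewrite /nb; case: eqVneq => [->|]; rewrite ?adj_irrefl ?andbT.
Qed.

Lemma nb_cliqueE A : reflect (nb_clique A) (clique A).
Proof.
apply: (iffP forallP) => [cA x y xA yA|cA x].
  move/implyP/(_ xA)/forallP/(_ y)/implyP/(_ yA): (cA x).
  by rewrite /nb -implyNb.
apply/implyP=> xA; apply/forallP=> y; apply/implyP=> yA; rewrite implyNb.
exact: cA.
Qed.

End ClosedAdjacency.

Arguments nb {G} x y.
Arguments nb_clique {G} A.

Ltac nbs := solve [assumption | rewrite nb_sym; assumption | apply: nb_refl].

(* Closed adjacency makes these statements free of distinctness hypotheses:
   none of the three graphs has two adjacent vertices with the same closed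
   neighbourhood, so every map to [G] respecting closed adjacency is injective. *)
Section Forbidden.
Variable G : sgraph.

Definition noC4 := forall a b c d : G,
  nb a b -> nb b c -> nb c d -> nb d a -> nb a c = false -> nb b d = false ->
  False.

Definition noC6 := forall a b c d e f : G,
  nb a b -> nb b c -> nb c d -> nb d e -> nb e f -> nb f a ->
  nb a c = false -> nb a d = false -> nb a e = false -> nb b d = false ->
  nb b e = false -> nb b f = false -> nb c e = false -> nb c f = false ->
  nb d f = false -> False.

Definition noP6 := forall a b c d e f : G,
  nb a b -> nb b c -> nb c d -> nb d e -> nb e f ->
  nb a c = false -> nb a d = false -> nb a e = false -> nb a f = false ->
  nb b d = false -> nb b e = false -> nb b f = false -> nb c e = false ->
  nb c f = false -> nb d f = false -> False.

Lemma induced_copy (H : sgraph) (g : H -> G) :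
    (forall i j, adj (g i) (g j) = adj i j) -> injective g ->
  exists A : {set G}, isomorphic (induced A) H.
Proof.
move=> gE g_inj; exists [set g i | i in H].
pose h (i : H) : induced [set g i | i in H] :=
  exist _ (g i) (imset_f g (isT : i \in predT)).
have h_bij : bijective h.
  apply: inj_card_bij => [i j [/g_inj]//|].
  by rewrite /= card_sig -(card_imset _ g_inj); apply/eq_leq/eq_card.
case: h_bij => f hK fK; exists f; first by exists h.
by move=> x y; rewrite -{2}(fK x) -{2}(fK y); apply/esym/gE.
Qed.

Lemma nb_copy (H : sgraph) (g : H -> G) :
    (forall i j, nb (g i) (g j) = nb i j) ->
    (forall i j : H, (forall k, nb i k = nb j k) -> i = j) ->
  exists A : {set G}, isomorphic (induced A) H.
Proof.
move=> gE Htf.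
have g_inj : injective g.
  by move=> i j ij; apply: Htf => k; rewrite -!gE ij.
by apply: (induced_copy (g := g)) => // i j; rewrite !adjE gE (inj_eq g_inj).
Qed.

Ltac ord_cases i := case: i => [[|[|[|[|[|[|?]]]]]] ?] //.

Lemma free_noC4 Hs : List.In (cycle_graph 4) Hs -> free Hs G -> noC4.
Proof.
move=> inH hG a b c d ab bc cd da ac bd.
have [||A] := @nb_copy (cycle_graph 4) (fun i => nth a [:: a; b; c; d] i);
  last exact: hG.
- move=> i j; ord_cases i; ord_cases j; rewrite [RHS]/nb /= ?nb_refl //; nbs.
- move=> i j; ord_cases i; ord_cases j => /=; try by move=> _; apply: val_inj.
  all: try by move/(_ (@Ordinal 4 0 isT)).
  all: try by move/(_ (@Ordinal 4 1 isT)).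
  all: try by move/(_ (@Ordinal 4 2 isT)).
  all: by move/(_ (@Ordinal 4 3 isT)).
Qed.

Lemma free_noC6 Hs : List.In (cycle_graph 6) Hs -> free Hs G -> noC6.
Proof.
move=> inH hG a b c d e f *.
have [||A] := @nb_copy (cycle_graph 6) (fun i => nth a [:: a; b; c; d; e; f] i);
  last exact: hG.
- move=> i j; ord_cases i; ord_cases j; rewrite [RHS]/nb /= ?nb_refl //; nbs.
- move=> i j; ord_cases i; ord_cases j => /=; try by move=> _; apply: val_inj.
  all: try by move/(_ (@Ordinal 6 0 isT)).
  all: try by move/(_ (@Ordinal 6 1 isT)).
  all: try by move/(_ (@Ordinal 6 2 isT)).
  all: try by move/(_ (@Ordinal 6 3 isT)).
  all: try by move/(_ (@Ordinal 6 4 isT)).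
  all: by move/(_ (@Ordinal 6 5 isT)).
Qed.

Lemma free_noP6 Hs : List.In (path_graph 6) Hs -> free Hs G -> noP6.
Proof.
move=> inH hG a b c d e f *.
have [||A] := @nb_copy (path_graph 6) (fun i => nth a [:: a; b; c; d; e; f] i);
  last exact: hG.
- move=> i j; ord_cases i; ord_cases j; rewrite [RHS]/nb /= ?nb_refl //; nbs.
- move=> i j; ord_cases i; ord_cases j => /=; try by move=> _; apply: val_inj.
  all: try by move/(_ (@Ordinal 6 0 isT)).
  all: try by move/(_ (@Ordinal 6 1 isT)).
  all: try by move/(_ (@Ordinal 6 2 isT)).
  all: try by move/(_ (@Ordinal 6 3 isT)).
  all: try by move/(_ (@Ordinal 6 4 isT)).
  all: by move/(_ (@Ordinal 6 5 isT)).
Qed.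

End Forbidden.

(** * Partial colourings *)

Section Colorings.
Variables (G : sgraph) (k : nat).
Implicit Types (x y z : G) (A B K : {set G}) (c : G -> nat).

Definition proper_on c A :=
  {in A, forall x, c x < k} /\ {in A &, forall x y, adj x y -> c x <> c y}.

Definition kcol A := exists c, proper_on c A.

Lemma proper_onS A B c : A \subset B -> proper_on c B -> proper_on c A.
Proof.
move=> /subsetP AB [c1 c2]; split=> [x /AB/c1//|x y /AB xB /AB yB].
exact: c2.
Qed.

Lemma kcol_colorable : kcol [set: G] -> colorable G k.
Proof.
case=> c [c1 c2]; have c_lt x : c x < k by apply: c1.
apply/existsP; exists [ffun x => Ordinal (c_lt x)].
apply/forallP=> x; apply/forallP=> y; apply/implyP=> xy; rewrite !ffunE.
by apply/eqP=> -[]; apply: c2.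
Qed.

(* An injective numbering of [B], pulled back along a map [r] that only
   identifies nonadjacent vertices. *)
Lemma retract_coloring A B (r : G -> G) :
    #|B| <= k -> {in A, forall x, r x \in B} ->
    {in A &, forall x y, r x = r y -> adj x y = false} ->
  exists2 c, proper_on c A & {in A &, forall x y, c x = c y <-> r x = r y}.
Proof.
move=> Bk rB rA; pose c x := index (r x) (enum B).
have cI : {in A &, forall x y, c x = c y -> r x = r y}.
  move=> x y xA yA e; have := @nth_index _ x (r x) (enum B).
  by rewrite mem_enum => /(_ (rB _ xA)) <-; rewrite -/(c x) e nth_index ?mem_enum ?rB.
exists c; last first.
  by move=> x y xA yA; split; [apply: cI | rewrite /c => ->].
split=> [x xA|x y xA yA xy /cI e].
  by apply: leq_trans Bk; rewrite cardE index_mem mem_enum rB.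
by rewrite rA ?e in xy.
Qed.

Lemma card_kcol A B (r : G -> G) :
    #|B| <= k -> {in A, forall x, r x \in B} ->
    {in A &, forall x y, r x = r y -> adj x y = false} -> kcol A.
Proof. by move=> h1 h2 h3; have [c] := retract_coloring h1 h2 h3; exists c. Qed.

Definition nswap (a b n : nat) := if n == a then b else if n == b then a else n.

(** Both colourings are injective on [s], so renaming colours carries one to the other there. The
    renaming is composed of one transposition per vertex, each leaving alone the values settled
    before. *)
Lemma align_coloring c1 c2 (s : seq G) :
    uniq s -> {in s, forall x, c1 x < k /\ c2 x < k} ->
    {in s &, injective c1} -> {in s &, injective c2} ->
  exists f : nat -> nat, [/\ injective f, forall n, n < k -> f n < k &
    {in s, forall x, f (c2 x) = c1 x}].
Proof.
elim: s => [|x s IH] /=; first by exists id; split.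
case/andP=> xs us lt i1 i2.
have sub y : y \in s -> y \in x :: s by rewrite inE orbC => ->.
have [|||f [fI fk fE]] := IH us.
- by move=> y /sub/lt.
- by move=> y z /sub ys /sub; apply: i1.
- by move=> y z /sub ys /sub; apply: i2.
have [xk1 xk2] := lt x (mem_head _ _).
exists (nswap (f (c2 x)) (c1 x) \o f); split.
- move=> m n /= e; apply: fI; move: e; rewrite /nswap.
  by do !case: eqP => ?; lia.
- by move=> n /fk; have := fk _ xk2; rewrite /nswap /=; do !case: eqP => ?; lia.
move=> y; rewrite inE => /predU1P[->|ys]; first by rewrite /= /nswap eqxx.
rewrite /= /nswap fE // ifN ?ifN //.
  by apply: contraNneq xs => /i1 <-; rewrite ?mem_head ?sub.
rewrite -fE //; apply: contraNneq xs => /fI/i2 <-; rewrite ?mem_head ?sub //.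
Qed.

(** The clique [A :&: B] has pairwise distinct colours in both colourings, so the colours of one can
    be renamed to make them agree on it. *)
Lemma glue_kcol A B :
    kcol A -> kcol B -> nb_clique (A :&: B) ->
    {in A :\: B & B :\: A, forall x y, adj x y = false} ->
  kcol (A :|: B).
Proof.
move=> [c1 [c1k c1P]] [c2 [c2k c2P]] cl AB.
have inj c : {in A :&: B &, forall x y, adj x y -> c x <> c y} ->
    {in enum (A :&: B) &, injective c}.
  move=> cP x y; rewrite !mem_enum => xK yK; have := cl x y xK yK.
  by rewrite /nb => /predU1P[//|/cP cxy] e; case: (cxy xK yK e).
have [|||f [fI fk fE]] := @align_coloring c1 c2 _ (enum_uniq (A :&: B)).
- by move=> x; rewrite mem_enum inE => /andP[/c1k ? /c2k].
- by apply: inj => x y; rewrite !inE => /andP[? _] /andP[? _]; apply: c1P.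
- by apply: inj => x y; rewrite !inE => /andP[_ ?] /andP[_ ?]; apply: c2P.
exists (fun x => if x \in A then c1 x else f (c2 x)); split.
  by move=> x; rewrite inE; case: ifP => [/c1k//|_ /= /c2k/fk].
have eB x : x \in A -> x \in B -> c1 x = f (c2 x).
  by move=> xA xB; rewrite fE // mem_enum inE xA.
move=> x y; rewrite !inE; case: ifP => xA; case: ifP => yA //= xB yB xy.
- exact: c1P.
- have [xB'|xB'] := boolP (x \in B); first by rewrite eB // => /fI; apply: c2P.
  by rewrite AB ?inE ?xA ?yA ?xB' in xy.
- have [yB'|yB'] := boolP (y \in B); first by rewrite eB // => /fI; apply: c2P.
  by rewrite adj_sym AB ?inE ?xA ?yA ?yB' in xy.
- by move/fI; apply: c2P.
Qed.

(* The neighbours in [A] coloured [g] forbid one colour altogether, whence the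
   bound [k - 2] on the number of the others. *)
Lemma greedy_extension c A B (g : nat) :
    1 < k -> proper_on c A ->
    {in B, forall x,
       #|[set y in A :|: B | adj x y && ~~ ((y \in A) && (c y == g))]| <= k - 2} ->
  exists2 c', proper_on c' (A :|: B) & {in A, c' =1 c}.
Proof.
move=> k1; move: {2}#|B| (leqnn #|B|) => n.
elim: n => [|n IH] in B *.
  rewrite leqn0 cards_eq0 => /eqP-> cA _; exists c => //.
  by rewrite setU0.
move=> Bn cA hB; have [->|[x xB]] := set_0Vmem B.
  by exists c; rewrite ?setU0.
have [||c' c'P c'E] := IH (B :\ x) _ cA.
- by rewrite (cardsD1 x) xB in Bn; lia.
- move=> y; rewrite inE => /andP[_ /hB]; apply: leq_trans.
  apply/subset_leq_card/subsetP=> z; rewrite !inE => /andP[].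
  by case: (z \in A) => //= /andP[_ ->].
have [xA|xA] := boolP (x \in A).
  exists c' => //; suff -> : A :|: B = A :|: (B :\ x) by [].
  by apply/setP=> z; rewrite !inE; case: eqP => [->|]; rewrite ?xA.
pose Y := [set y in A :|: (B :\ x) | adj x y].
have YC : #|[set (inord (c' y) : 'I_k.+1) | y in Y]| < k.
  pose Y' := [set y in A :|: B | adj x y && ~~ ((y \in A) && (c y == g))].
  apply: (@leq_ltn_trans
    #|(inord g : 'I_k.+1) |: [set (inord (c' y) : 'I_k.+1) | y in Y']|).
    apply/subset_leq_card/subsetP=> _ /imsetP[y yY ->]; rewrite !inE.
    have [/andP[yA /eqP yg]|yg] := boolP ((y \in A) && (c y == g)).
      by rewrite c'E // yg eqxx.
    apply/orP; right; apply: imset_f; move: yY; rewrite !inE yg.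
    by case: (y \in A) => /= [->|/andP[/andP[_ ->] ->]].
  rewrite cardsU1; have := hB x xB.
  have := leq_imset_card (fun y => inord (c' y) : 'I_k.+1) Y'.
  by rewrite -/Y'; case: (_ \notin _); lia.
have [i iY] : exists i : 'I_k,
    widen_ord (leqnSn k) i \notin [set (inord (c' y) : 'I_k.+1) | y in Y].
  apply/existsP; apply: contraTT YC; rewrite negb_exists => /forallP h.
  have wI : injective (widen_ord (leqnSn k)) by move=> i j [/val_inj].
  rewrite -leqNgt -[X in X <= _]card_ord -(card_imset _ wI).
  by apply/subset_leq_card/subsetP=> _ /imsetP[i _ ->]; apply: negbNE (h i).
have YE y : y \in A :|: B -> y != x -> adj x y -> c' y <> i.
  move=> yAB yx xy e; case/negP: iY; apply/imsetP; exists y.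
    by rewrite inE xy andbT; move: yAB; rewrite !inE yx.
  by apply: val_inj; rewrite /= inordK e // ltnS ltnW.
exists (fun y => if y == x then val i else c' y); last first.
  by move=> y yA; rewrite ifN ?c'E //; apply: contraNneq xA => <-.
have sub y : y != x -> y \in A :|: B -> y \in A :|: (B :\ x).
  by rewrite !inE => ->.
case: c'P => c'k c'P; split=> [y yAB|y z yAB zAB].
  case: ifPn => [_|yx] ; first exact: ltn_ord.
  exact: c'k (sub _ yx yAB).
case: ifPn => [/eqP->|yx]; case: ifPn => [/eqP->|zx]; rewrite ?adj_irrefl //.
- by move=> /YE h; apply/nesym/h.
- by rewrite adj_sym; apply: YE.
- by apply: c'P; apply: sub.
Qed.

End Colorings.

(** * Hall's marriage theorem *)

Lemma hall (T U : finType) (u0 : U) (L : T -> {set U}) (D : {set T}) :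
    (forall X : {set T}, X \subset D -> #|X| <= #|\bigcup_(x in X) L x|) ->
  exists f : T -> U, {in D, forall x, f x \in L x} /\ {in D &, injective f}.
Proof.
have [n] := ubnP #|D|; elim: n L D => // n IH L D Dn hL.
have [->|[d dD]] := set_0Vmem D.
  by exists (fun=> u0); split=> [x|x y]; rewrite inE.
have bigD (u : {set U}) (Y : {set T}) :
    \bigcup_(x in Y) (L x :\: u) = (\bigcup_(x in Y) L x) :\: u.
  apply/setP=> v; rewrite inE; apply/bigcupP/andP.
    by case=> x xY; rewrite inE => /andP[-> vx]; split=> //; apply/bigcupP; exists x.
  by case=> vu /bigcupP[x xY vx]; exists x; rewrite // inE vu.
(* A tight proper subset is matched within its own lists and the rest with what remains. Without
   one, every nonempty proper subset has a value to spare, so any choice [u] for a single element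
   [d] can be withdrawn from the other lists. *)
pose tight X := [&& X != set0, X \proper D & #|\bigcup_(x in X) L x| <= #|X|].
have [X /and3P[X0 XD Xt]|notight] := pickP tight.
  have [||f1 [f1L f1I]] := IH L X.
  - by have := proper_card XD; lia.
  - by move=> Y YX; apply: hL (subset_trans YX (proper_sub XD)).
  have [||f2 [f2L f2I]] := IH (fun x => L x :\: \bigcup_(x in X) L x) (D :\: X).
  - suff /proper_card : D :\: X \proper D by lia.
    rewrite properEneq subsetDl andbT; apply: contraNneq X0 => e.
    rewrite -subset0; apply/subsetP=> x xX.
    by have := subsetP (proper_sub XD) x xX; rewrite -e inE xX.
  - move=> Y; rewrite subsetD => /andP[YD dis]; rewrite bigD.
    have := hL (Y :|: X); rewrite subUset YD (proper_sub XD) => /(_ isT).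
    rewrite bigcup_setU cardsU (disjoint_setI0 dis) cards0.
    by rewrite cardsD cardsU; move: Xt; lia.
  exists (fun x => if x \in X then f1 x else f2 x); split=> [x xD|x y xD yD].
    case: ifPn => [/f1L//|xX].
    by have := f2L x; rewrite !inE xX xD => /(_ isT) /andP[].
  case: ifPn => xX; case: ifPn => yX.
  - exact: f1I.
  - move=> e; have := f2L y; rewrite !inE yX yD => /(_ isT) /andP[/bigcupP[]].
    by exists x => //; rewrite -e f1L.
  - move=> e; have := f2L x; rewrite !inE xX xD => /(_ isT) /andP[/bigcupP[]].
    by exists y => //; rewrite e f1L.
  - by apply: f2I; rewrite inE ?xX ?yX.
have [u ud] : exists u, u \in L d.
  have := hL [set d]; rewrite sub1set big_set1 cards1 => /(_ dD).
  by case/card_gt0P=> u; exists u.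
have [||f [fL fI]] := IH (fun x => L x :\: [set u]) (D :\ d).
- by rewrite (cardsD1 d) dD in Dn; lia.
- move=> Y YD; rewrite bigD; have [->|Y0] := eqVneq Y set0; first by rewrite cards0.
  have := notight Y; rewrite /tight Y0 (sub_proper_trans YD) ?properD1 //=.
  move/negbT; rewrite -ltnNge => lt.
  by have := cardsD1 u (\bigcup_(x in Y) L x); case: (_ \in _) => /= e; lia.
exists (fun x => if x == d then u else f x); split=> [x xD|x y xD yD].
  case: eqP => [->//|/eqP xd].
  by have := fL x; rewrite !inE xd xD => /(_ isT) /andP[].
have fu z : z \in D -> z != d -> f z != u.
  by move=> zD zd; have := fL z; rewrite !inE zd zD => /(_ isT) /andP[].
case: (altP (x =P d)) => [->|xd]; case: (altP (y =P d)) => [->|yd] //.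
- by move=> e; have := fu y yD yd; rewrite -e eqxx.
- by move=> e; have := fu x xD xd; rewrite e eqxx.
- by apply: fI; rewrite !inE ?xd ?yd.
Qed.

(** * Critical graphs *)

Section Linking.
Variable G : sgraph.
Implicit Types (x y z : G) (P : {set G}).

Definition inside P : rel G := [rel u v | [&& u \in P, v \in P & adj u v]].

(** For nonadjacent [x] and [y]: an induced path between them with one, two or three inner vertices,
    all in [P]. A fourth inner vertex would make a [P_6]. *)
Variant link_spec P x y : Prop :=
| Link1 p of p \in P & nb x p & nb p y
| Link2 p q of p \in P & q \in P & nb x p & nb p q & nb q y
    & nb x q = false & nb p y = false
| Link3 p q r of p \in P & q \in P & r \in P
    & nb x p & nb p q & nb q r & nb r y
    & nb x q = false & nb x r = false & nb x y = false
    & nb p r = false & nb p y = false & nb q y = false.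

(** A chord among the first six vertices shortens the walk; without one, a walk with four or more
    inner vertices begins with an induced [P_6]. *)
Lemma link P x y p q : noP6 G -> nb x y = false -> p \in P ->
  connect (inside P) p q -> nb x p -> nb q y -> link_spec P x y.
Proof.
move=> hP6 nxy pP /connectP[s s_path ->] xp qy {q}.
have [t [tP tp]] : exists t, all (mem P) t /\ path nb x (rcons t y).
  exists (p :: s); rewrite /= rcons_path xp qy andbT pP; split.
    by elim: s {qy} p s_path {xp pP} => //= a s IH p /andP[/and3P[_ -> _] /IH].
  by apply: sub_path s_path => u v /and3P[_ _ /adj_nb].
have [n] := ubnP (size t); elim: n t tP tp => // n IH t tP tp tn.
have short t' : size t' < size t -> all (mem P) t' -> path nb x (rcons t' y) ->
  link_spec P x y by move=> lt h1 h2; apply: (IH t') => //; lia.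
case: t => [|p1 [|p2 t]] in tP tp {tn} short *.
- by rewrite /= nxy in tp.
- by move: tP tp; rewrite /= !andbT => P1 /andP[]; exact: (Link1 P1).
have [x2|/negbTE x2] := boolP (nb x p2).
  apply: (short (p2 :: t)) => //; first by case/andP: tP.
  by move: tp; rewrite /= x2 => /and3P[_ _ ->].
case: t => [|p3 t] in tP tp short *.
  move: tP tp; rewrite /= !andbT => /andP[P1 P2] /and3P[x1 p12 p2y].
  have [p1y|/negbTE p1y] := boolP (nb p1 y); first exact: (Link1 P1).
  exact: (Link2 P1 P2).
have [x3|/negbTE x3] := boolP (nb x p3).
  apply: (short (p3 :: t)) => //; first by case/and3P: tP.
  by move: tp; rewrite /= x3 => /and4P[].
have [p13|/negbTE p13] := boolP (nb p1 p3).
  apply: (short [:: p1, p3 & t]) => //; first by move: tP => /= /and3P[-> _ ->].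
  by move: tp; rewrite /= p13 => /and4P[-> _ _ ->].
case: t => [|p4 t] in tP tp short *.
  move: tP tp; rewrite /= !andbT => /and3P[P1 P2 P3] /and4P[x1 p12 p23 p3y].
  have [p1y|/negbTE p1y] := boolP (nb p1 y); first exact: (Link1 P1).
  have [p2y|/negbTE p2y] := boolP (nb p2 y); first exact: (Link2 P1 P2).
  exact: (Link3 P1 P2 P3).
have [x4|/negbTE x4] := boolP (nb x p4).
  apply: (short (p4 :: t)) ; first (by clear; rewrite /=; lia); first by case/and4P: tP.
  by move: tp; rewrite /= x4 => /and5P[].
have [p14|/negbTE p14] := boolP (nb p1 p4).
  apply: (short [:: p1, p4 & t]) ; first (by clear; rewrite /=; lia); first by move: tP => /= /and4P[-> _ _ ->].
  by move: tp; rewrite /= p14 => /and5P[-> _ _ _ ->].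
have [p24|/negbTE p24] := boolP (nb p2 p4).
  apply: (short [:: p1, p2, p4 & t]) ; first by clear; rewrite /=; lia.
    by move: tP => /= /and4P[-> -> _ ->].
  by move: tp; rewrite /= p24 => /and5P[-> -> _ _ ->].
case: t => [|p5 t] in tP tp short *.
  move: tP tp; rewrite /= !andbT => /and4P[P1 P2 P3 P4] /and5P[x1 p12 p23 p34 p4y].
  have [p1y|/negbTE p1y] := boolP (nb p1 y); first exact: (Link1 P1).
  have [p2y|/negbTE p2y] := boolP (nb p2 y); first exact: (Link2 P1 P2).
  have [p3y|/negbTE p3y] := boolP (nb p3 y); first exact: (Link3 P1 P2 P3).
  by case: (hP6 x p1 p2 p3 p4 y).
move: tP tp; rewrite /= => /and5P[P1 P2 P3 P4 /andP[P5 Pt]].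
move=> /and5P[x1 p12 p23 p34 /andP[p45 tp]].
have [x5|/negbTE x5] := boolP (nb x p5).
  by apply: (short (p5 :: t)); rewrite /= ?x5 ?P5 //=; clear; lia.
have [p15|/negbTE p15] := boolP (nb p1 p5).
  by apply: (short [:: p1, p5 & t]); rewrite /= ?P1 ?p15 ?P5 ?x1 //=; clear; lia.
have [p25|/negbTE p25] := boolP (nb p2 p5).
  by apply: (short [:: p1, p2, p5 & t]); rewrite /= ?P1 ?P2 ?p12 ?p25 ?P5 ?x1 //=; clear; lia.
have [p35|/negbTE p35] := boolP (nb p3 p5).
  apply: (short [:: p1, p2, p3, p5 & t]);
    by rewrite /= ?P1 ?P2 ?P3 ?p12 ?p23 ?p35 ?P5 ?x1 //=; clear; lia.
by case: (hP6 x p1 p2 p3 p4 p5).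
Qed.

End Linking.

(** Degrees are bounded by the fixed number [k.+2] on closed neighbourhoods, not in terms of the
    maximum degree of [G], so that the bound passes to induced subgraphs. *)
Record critical (k : nat) (G : sgraph) : Prop := Critical {
  critical_noC4 : noC4 G;
  critical_noC6 : noC6 G;
  critical_noP6 : noP6 G;
  critical_degree : forall x : G, #|[set y | nb x y]| <= k.+2;
  critical_clique : forall A : {set G}, nb_clique A -> #|A| <= k;
  critical_proper : forall A : {set G}, A != setT -> kcol k A;
  critical_not_kcol : ~ kcol k [set: G] }.

Section Cutset.
Variables (k : nat) (G : sgraph).
Hypothesis Gk : critical k G.
Implicit Types (x y z : G) (P : {set G}).

(* Otherwise [x] and [w] would be separated by a clique, and colourings of the
   two sides would glue. *)
Lemma component_boundary P x w : x \in P -> {in P, forall u, nb u w = false} ->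
  exists y z p q, [/\ nb y z = false, y \notin P & z \notin P] /\
    [/\ p \in P, connect (inside P) p q, q \in P, nb y p & nb q z].
Proof.
move=> xP wP; pose K := [set u | connect (inside P) x u].
have KP u : u \in K -> u \in P.
  rewrite inE => /connectP[s sp ->] {u}.
  elim: s (x) xP sp => //= a s IH b _ /andP[/and3P[_ aP _] /IH]; exact.
have Ksym : connect_sym (inside P).
  apply: sym_connect_sym => u v; rewrite /inside /=.
  by rewrite adj_sym; case: (u \in P); case: (v \in P).
pose N := [set v | (v \notin P) && [exists u in K, nb v u]].
have xK : x \in K by rewrite inE connect0.
have [/existsP[y /andP[yN /existsP[z /andP[zN yz]]]]|cl] :=
    boolP [exists y in N, [exists z in N, ~~ nb y z]].
  move: yN zN; rewrite !inE => /andP[yP /existsP[p /andP[pK yp]]].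
  case/andP=> [zP /existsP[q /andP[qK qz]]].
  exists y, z, p, q; split; first by split=> //; exact: negbTE.
  split; rewrite ?(nb_sym q) // ?[_ \in P]KP //.
  by move: pK qK; rewrite !inE Ksym; apply: connect_trans.
case: (critical_not_kcol Gk); have -> : [set: G] = (K :|: N) :|: ~: K.
  by apply/setP=> u; rewrite !in_setU in_setC in_setT; case: (u \in K); rewrite ?orbT.
have wK : w \notin K by apply/negP=> /KP/wP; rewrite nb_refl.
apply: glue_kcol.
- apply: (critical_proper Gk); apply: contraTneq isT => /setP/(_ w).
  rewrite !in_setU (negbTE wK) !inE; case: existsP => [[u /andP[uK]]|];
    last by rewrite andbF.
  by rewrite nb_sym wP // KP.
- by apply: (critical_proper Gk); apply: contraTneq xK => /setP/(_ x); rewrite !inE => ->.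
- move=> y z; rewrite !in_setI !in_setU !in_setC => /andP[yKN yK] /andP[zKN zK].
  rewrite (negbTE yK) /= in yKN; rewrite (negbTE zK) /= in zKN.
  move: cl; rewrite negb_exists => /forallP/(_ y); rewrite yKN negb_exists /=.
  by move/forallP/(_ z); rewrite zKN negbK.
move=> u v; rewrite !in_setD !in_setU !in_setC negbK negb_or.
move=> /andP[uK _] /andP[/andP[vK vN] _].
apply: contraNF vN => uv; rewrite inE; apply/andP; split; last first.
  by apply/existsP; exists u; rewrite uK nb_sym adj_nb.
apply: contraNN vK => vP; rewrite inE; apply: connect_trans (_ : connect _ u _).
  by rewrite inE in uK.
by apply: connect1; rewrite /inside /= KP // vP.
Qed.

End Cutset.

(** * Five-cycles and pyramids *)

Record C5 (G : sgraph) (v1 v2 v3 v4 v5 : G) : Prop := MkC5 {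
  c5_12 : nb v1 v2; c5_23 : nb v2 v3; c5_34 : nb v3 v4; c5_45 : nb v4 v5;
  c5_51 : nb v5 v1;
  c5_13 : nb v1 v3 = false; c5_24 : nb v2 v4 = false; c5_35 : nb v3 v5 = false;
  c5_41 : nb v4 v1 = false; c5_52 : nb v5 v2 = false }.

Record pyramid (G : sgraph) (a a1 a2 a3 c1 c2 c3 : G) : Prop := MkPyramid {
  pyr_a1 : nb a a1; pyr_a2 : nb a a2; pyr_a3 : nb a a3;
  pyr_1 : nb a1 c1; pyr_2 : nb a2 c2; pyr_3 : nb a3 c3;
  pyr_c12 : nb c1 c2; pyr_c23 : nb c2 c3; pyr_c31 : nb c3 c1;
  pyr_ac1 : nb a c1 = false; pyr_ac2 : nb a c2 = false; pyr_ac3 : nb a c3 = false;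
  pyr_a12 : nb a1 a2 = false; pyr_a23 : nb a2 a3 = false; pyr_a31 : nb a3 a1 = false;
  pyr_1c2 : nb a1 c2 = false; pyr_1c3 : nb a1 c3 = false;
  pyr_2c1 : nb a2 c1 = false; pyr_2c3 : nb a2 c3 = false;
  pyr_3c1 : nb a3 c1 = false; pyr_3c2 : nb a3 c2 = false }.

(* Since adjacency is closed here, a vertex of the five-cycle has the same pattern
   as a vertex attached to it and its two neighbours on the cycle. *)
Definition pat (G : sgraph) (v1 v2 v3 v4 v5 x : G) (b1 b2 b3 b4 b5 : bool) : Prop :=
  [/\ nb x v1 = b1, nb x v2 = b2, nb x v3 = b3, nb x v4 = b4 & nb x v5 = b5].

Section Linked.
Variable G : sgraph.
Implicit Types (x y z w : G) (P : {set G}).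

Definition anti P w := {in P, forall u, nb u w = false}.

Definition linked P x y := exists p q,
  [/\ p \in P, connect (inside P) p q, q \in P, nb x p & nb y q].

Lemma linked_sym P x y : linked P x y -> linked P y x.
Proof.
case=> p [q [pP pq qP xp yq]]; exists q, p; split=> //.
rewrite sym_connect_sym // => u v; rewrite /inside /= adj_sym.
by case: (u \in P); case: (v \in P).
Qed.

Hypotheses (h6 : noC6 G) (hP : noP6 G).

Lemma linkedP P x y : nb x y = false -> linked P x y -> link_spec P x y.
Proof.
by move=> xy [p [q [pP pq _ xp yq]]]; apply: (link hP xy pP pq xp); rewrite nb_sym.
Qed.

(** The path [x w1 w2 y] runs outside [P]. With an induced path through [P] it closes a [C_6] if
    that path has two inner vertices and yields a [P_6] if it has three, so there is only one. *)
Lemma out3 P x y w1 w2 : nb x y = false -> linked P x y ->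
    anti P w1 -> anti P w2 ->
    nb x w1 -> nb w1 w2 -> nb w2 y -> nb x w2 = false -> nb w1 y = false ->
  exists2 p, p \in P & nb x p /\ nb p y.
Proof.
move=> xy /linkedP-/(_ xy) L P1 P2 x1 w12 w2y x2 w1y; case: L.
- by move=> p; exists p.
- move=> p q pP qP *; case: (h6 (a := x) (b := p) (c := q) (d := y) (e := w2) (f := w1));
    by [nbs | apply: P1 | apply: P2].
- move=> p q r pP qP rP *.
  case: (hP (a := x) (b := p) (c := q) (d := r) (e := y) (f := w2));
    by [nbs | apply: P1 | apply: P2].
Qed.

(** The outer path is longer by one vertex: a single inner vertex in [P] already closes a [C_6], and
    two or three yield a [P_6]. *)
Lemma out4 P x y w1 w2 w3 : nb x y = false -> linked P x y ->
    anti P w1 -> anti P w2 -> anti P w3 ->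
    nb x w1 -> nb w1 w2 -> nb w2 w3 -> nb w3 y -> nb x w2 = false ->
    nb x w3 = false -> nb w1 w3 = false -> nb w1 y = false -> nb w2 y = false ->
  False.
Proof.
move=> xy /linkedP-/(_ xy) L P1 P2 P3 *; case: L.
- move=> p pP *; apply: (h6 (a := x) (b := p) (c := y) (d := w3) (e := w2) (f := w1));
    by [nbs | apply: P1 | apply: P2 | apply: P3].
- move=> p q pP qP *.
  apply: (hP (a := p) (b := q) (c := y) (d := w3) (e := w2) (f := w1));
    by [nbs | apply: P1 | apply: P2 | apply: P3].
- move=> p q r pP qP rP *.
  apply: (hP (a := p) (b := q) (c := r) (d := y) (e := w3) (f := w2));
    by [nbs | apply: P1 | apply: P2 | apply: P3].
Qed.

End Linked.

(** * Every five-cycle dominates *)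

Section FiveCycle.
Variables (k : nat) (G : sgraph).
Hypothesis Gk : critical k G.
Implicit Types (x y z t : G) (P : {set G}).

Let h4 := critical_noC4 Gk.
Let h6 := critical_noC6 Gk.
Let hP := critical_noP6 Gk.

Lemma boundary P x w : x \in P -> anti P w ->
  exists y z, [/\ nb y z = false, y \notin P, z \notin P & linked P y z].
Proof.
move=> xP wP; have [y [z [p [q [[yz yP zP] [pP pq qP yp qz]]]]]] :=
  component_boundary Gk xP wP.
by exists y, z; split=> //; exists p, q; split=> //; rewrite nb_sym.
Qed.

(** Two nonadjacent neighbours of [x] on the boundary of a component of its nonneighbours, joined
    through that component, close a hole of length four, five or six with [x], and only five is
    allowed. If there are no nonadjacent vertices, the graph is a clique with at most [k]
    vertices. *)
Lemma C5_exists : exists v1 v2 v3 v4 v5 : G, C5 v1 v2 v3 v4 v5.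
Proof.
have [/existsP[x /existsP[y xy]]|cl] := boolP [exists x : G, exists y, ~~ nb x y].
  have yP : y \in [set u | ~~ nb x u] by rewrite inE.
  have xP : anti [set u | ~~ nb x u] x.
    by move=> u; rewrite inE nb_sym => /negbTE.
  have [y' [z' [yz]]] := boundary yP xP.
  rewrite !inE !negbK => xy' xz' /(linkedP hP yz).
  case=> [p|p q|p q r]; rewrite !inE => /negbTE xp.
  - by move=> *; case: (h4 (a := x) (b := y') (c := p) (d := z')); nbs.
  - by move=> /negbTE xq *; exists x, y', p, q, z'; split; nbs.
  - move=> /negbTE xq /negbTE xr *.
    by case: (h6 (a := x) (b := y') (c := p) (d := q) (e := r) (f := z')); nbs.
case: (critical_not_kcol Gk).
apply: (card_kcol (B := setT) (r := id)) => //; last first.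
  by move=> x y _ _ ->; rewrite adj_irrefl.
apply: (critical_clique Gk) => x y _ _.
move: cl; rewrite negb_exists => /forallP/(_ x); rewrite negb_exists.
by move/forallP/(_ y); rewrite negbK.
Qed.

Lemma C5_rot v1 v2 v3 v4 v5 : C5 v1 v2 v3 v4 v5 -> C5 v2 v3 v4 v5 (v1 : G).
Proof. by case=> *; split; nbs. Qed.

Lemma C5_rev v1 v2 v3 v4 v5 : C5 v1 v2 v3 v4 v5 -> C5 v1 v5 v4 v3 (v2 : G).
Proof. by case=> *; split; nbs. Qed.

(** Otherwise [x v1 v2 v3] is a four-cycle. Applied around the cycle, this leaves as nonempty traces
    only the arcs of one, two or three vertices and the whole cycle. *)
Lemma C5_arc v1 v2 v3 v4 v5 x : C5 v1 v2 v3 v4 v5 ->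
  nb x v1 && nb x v3 ==> nb x v2.
Proof.
case=> *; apply/implyP=> /andP[? ?]; apply: contraT => /negbTE ?; exfalso.
by apply: (h4 (a := x) (b := v1) (c := v2) (d := v3)); nbs.
Qed.

Lemma C5_common v1 v2 v3 v4 v5 x y : C5 v1 v2 v3 v4 v5 ->
  nb x v1 -> nb x v3 -> nb y v1 -> nb y v3 -> nb x y.
Proof.
case=> *; apply: contraT => /negbTE ?; exfalso.
by apply: (h4 (a := x) (b := v1) (c := y) (d := v3)); nbs.
Qed.

Definition anti5 v1 v2 v3 v4 v5 := [set z : G |
  [&& ~~ nb z v1, ~~ nb z v2, ~~ nb z v3, ~~ nb z v4 & ~~ nb z v5]].

Section Dominating.
Variables v1 v2 v3 v4 v5 : G.

(** If [y] missed [v2] or [v5], then [z y v1 v2 v3 v4] or [z y v1 v5 v4 v3] would be a [P_6]. *)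
Lemma anti5_leaf y z : C5 v1 v2 v3 v4 v5 -> nb z v1 = false -> nb z v2 = false ->
    nb z v3 = false -> nb z v4 = false -> nb z v5 = false -> nb y z ->
  [&& nb y v1, ~~ nb y v3 & ~~ nb y v4] ==> nb y v2 && nb y v5.
Proof.
case=> *; apply/implyP=> /and3P[? /negbTE ? /negbTE ?].
apply/andP; split; apply: contraT => /negbTE ?; exfalso.
  by apply: (hP (a := z) (b := y) (c := v1) (d := v2) (e := v3) (f := v4)); nbs.
by apply: (hP (a := z) (b := y) (c := v1) (d := v5) (e := v4) (f := v3)); nbs.
Qed.

Lemma anti5_rot : anti5 v2 v3 v4 v5 v1 = anti5 v1 v2 v3 v4 v5.
Proof.
apply/setP=> z; rewrite !inE.
by case: (nb z v1) (nb z v2) (nb z v3) (nb z v4) (nb z v5) => [] [] [] [] [].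
Qed.

Lemma anti5_rev : anti5 v1 v5 v4 v3 v2 = anti5 v1 v2 v3 v4 v5.
Proof.
apply/setP=> z; rewrite !inE.
by case: (nb z v1) (nb z v2) (nb z v3) (nb z v4) (nb z v5) => [] [] [] [] [].
Qed.

Lemma anti5_anti : [/\ anti (anti5 v1 v2 v3 v4 v5) v1,
  anti (anti5 v1 v2 v3 v4 v5) v2, anti (anti5 v1 v2 v3 v4 v5) v3,
  anti (anti5 v1 v2 v3 v4 v5) v4 & anti (anti5 v1 v2 v3 v4 v5) v5].
Proof.
by split=> z; rewrite inE => /and5P[/negbTE? /negbTE? /negbTE? /negbTE? /negbTE?].
Qed.

Lemma anti5_12 y z : C5 v1 v2 v3 v4 v5 ->
  pat v1 v2 v3 v4 v5 y true true false false true ->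
  pat v1 v2 v3 v4 v5 z true true true false false ->
  nb y z = false -> linked (anti5 v1 v2 v3 v4 v5) y z -> False.
Proof.
case=> ? ? ? ? ? ? ? ? ? ? [? ? ? ? ?] [? ? ? ? ?] ? ?; have [? ? ? ? ?] := anti5_anti.
by apply: (out4 h6 hP (w1 := v5) (w2 := v4) (w3 := v3) (P := anti5 v1 v2 v3 v4 v5)
  (x := y) (y := z)); nbs.
Qed.

Lemma anti5_13 y z : C5 v1 v2 v3 v4 v5 ->
  pat v1 v2 v3 v4 v5 y true true false false true ->
  pat v1 v2 v3 v4 v5 z false true true true false ->
  nb y z = false -> linked (anti5 v1 v2 v3 v4 v5) y z -> False.
Proof.
case=> ? ? ? ? ? ? ? ? ? ? [? ? ? ? ?] [? ? ? ? ?] ? ?; have [? P2 ? ? ?] := anti5_anti.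
have [|||||||||p pP []] := out3 h6 hP (w1 := v5) (w2 := v4) (x := y) (y := z)
  (P := anti5 v1 v2 v3 v4 v5); try nbs.
have ? := P2 p pP.
by move=> ? ?; apply: (h4 (a := y) (b := p) (c := z) (d := v2)); nbs.
Qed.
End Dominating.

(** The traces left to a neighbour of an undominated vertex: [RingB1] to [RingB5] are those of [v1]
    to [v5] themselves, [RingU] is the whole cycle. *)
Variant ring_spec v1 v2 v3 v4 v5 y : Prop :=
| RingB1 of pat v1 v2 v3 v4 v5 y true true false false true
| RingB2 of pat v1 v2 v3 v4 v5 y true true true false false
| RingB3 of pat v1 v2 v3 v4 v5 y false true true true false
| RingB4 of pat v1 v2 v3 v4 v5 y false false true true true
| RingB5 of pat v1 v2 v3 v4 v5 y true false false true true
| RingU of pat v1 v2 v3 v4 v5 y true true true true true.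

Lemma pat_rot v1 v2 v3 v4 v5 x b1 b2 b3 b4 b5 :
  pat v1 v2 v3 v4 v5 x b1 b2 b3 b4 b5 -> pat v2 v3 v4 v5 v1 x b2 b3 b4 b5 b1.
Proof. by case. Qed.

Lemma pat_rev v1 v2 v3 v4 v5 x b1 b2 b3 b4 b5 :
  pat v1 v2 v3 v4 v5 x b1 b2 b3 b4 b5 -> pat v1 v5 v4 v3 v2 x b1 b5 b4 b3 b2.
Proof. by case. Qed.

Lemma ring_spec_rot v1 v2 v3 v4 v5 y :
  ring_spec v1 v2 v3 v4 v5 y -> ring_spec v2 v3 v4 v5 v1 y.
Proof.
by case=> /pat_rot;
  [apply: RingB5 | apply: RingB1 | apply: RingB2 | apply: RingB3
  | apply: RingB4 | apply: RingU].
Qed.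

Lemma anti5_ring v1 v2 v3 v4 v5 y z : C5 v1 v2 v3 v4 v5 ->
  z \in anti5 v1 v2 v3 v4 v5 -> nb y z -> y \notin anti5 v1 v2 v3 v4 v5 ->
  ring_spec v1 v2 v3 v4 v5 y.
Proof.
move=> C; rewrite !inE => /and5P[/negbTE? /negbTE? /negbTE? /negbTE? /negbTE?] yz.
have D := C5_rot C; have E := C5_rot D; have F := C5_rot E; have H := C5_rot F.
have a1 := C5_arc y C; have a2 := C5_arc y D; have a3 := C5_arc y E.
have a4 := C5_arc y F; have a5 := C5_arc y H.
have b1 : [&& nb y v1, ~~ nb y v3 & ~~ nb y v4] ==> nb y v2 && nb y v5.
  by apply: (anti5_leaf (z := z) C).
have b2 : [&& nb y v2, ~~ nb y v4 & ~~ nb y v5] ==> nb y v3 && nb y v1.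
  by apply: (anti5_leaf (z := z) D).
have b3 : [&& nb y v3, ~~ nb y v5 & ~~ nb y v1] ==> nb y v4 && nb y v2.
  by apply: (anti5_leaf (z := z) E).
have b4 : [&& nb y v4, ~~ nb y v1 & ~~ nb y v2] ==> nb y v5 && nb y v3.
  by apply: (anti5_leaf (z := z) F).
have b5 : [&& nb y v5, ~~ nb y v2 & ~~ nb y v3] ==> nb y v1 && nb y v4.
  by apply: (anti5_leaf (z := z) H).
move=> nz; move: a1 a2 a3 a4 a5 b1 b2 b3 b4 b5 nz.
case e1: (nb y v1); case e2: (nb y v2); case e3: (nb y v3); case e4: (nb y v4);
  case e5: (nb y v5) => //= *.
all: first [by apply: RingB1 | by apply: RingB2 | by apply: RingB3
  | by apply: RingB4 | by apply: RingB5 | by apply: RingU].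
Qed.

Lemma linkedS P y z : linked P y z -> exists2 p, p \in P & nb y p.
Proof. by case=> p [q [pP _ _ yp _]]; exists p. Qed.

(** If [z] has the trace of [y] or the whole cycle, the common neighbours [v5] and [v2] force an
    edge. Up to reflection the other traces belong to a vertex at distance one or two on the cycle,
    where an outer path along the cycle applies. *)
Lemma ring_pair v1 v2 v3 v4 v5 y z : C5 v1 v2 v3 v4 v5 ->
  pat v1 v2 v3 v4 v5 y true true false false true ->
  ring_spec v1 v2 v3 v4 v5 z -> nb y z = false ->
  linked (anti5 v1 v2 v3 v4 v5) y z -> False.
Proof.
move=> C py pz yz L; move: (py) => [y1 y2 y3 y4 y5].
have C' := C5_rot (C5_rot (C5_rot (C5_rot C))).
case: pz => pz; last 1 first.
- by case: pz => *; rewrite (C5_common C') in yz.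
- by case: pz => *; rewrite (C5_common C') in yz.
- exact: anti5_12 C py pz yz L.
- exact: anti5_13 C py pz yz L.
- by rewrite -anti5_rev in L; apply: anti5_13 (C5_rev C) (pat_rev py) (pat_rev pz) yz L.
- by rewrite -anti5_rev in L; apply: anti5_12 (C5_rev C) (pat_rev py) (pat_rev pz) yz L.
Qed.

(* The component of an undominated vertex would have a clique boundary. *)
Lemma C5_dominating v1 v2 v3 v4 v5 : C5 v1 v2 v3 v4 v5 ->
  anti5 v1 v2 v3 v4 v5 = set0.
Proof.
move=> C; apply/eqP; apply: contraT => /set0Pn[x xP].
have [P1 _ _ _ _] := anti5_anti v1 v2 v3 v4 v5.
have [y [z [yz yP zP L]]] := boundary xP P1.
have [p pP yp] := linkedS L; have [q qP zq] := linkedS (linked_sym L).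
have ry := anti5_ring C pP yp yP; have rz := anti5_ring C qP zq zP.
exfalso; have L1 := L; have L2 := L; have L3 := L; have L4 := L.
rewrite -anti5_rot in L1; rewrite -2!anti5_rot in L2; rewrite -3!anti5_rot in L3.
rewrite -4!anti5_rot in L4.
have D := C5_rot C; have E := C5_rot D; have F := C5_rot E; have H := C5_rot F.
have rz1 := ring_spec_rot rz; have rz2 := ring_spec_rot rz1.
have rz3 := ring_spec_rot rz2; have rz4 := ring_spec_rot rz3.
case: ry => py.
- exact: ring_pair C py rz yz L.
- exact: ring_pair D (pat_rot py) rz1 yz L1.
- exact: ring_pair E (pat_rot (pat_rot py)) rz2 yz L2.
- exact: ring_pair F (pat_rot (pat_rot (pat_rot py))) rz3 yz L3.
- exact: ring_pair H (pat_rot (pat_rot (pat_rot (pat_rot py)))) rz4 yz L4.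
have [y1 y2 y3 y4 y5] := py.
case: rz => -[z1 z2 z3 z4 z5]; suff : nb y z by rewrite yz.
- exact: (C5_common H).
- exact: (C5_common C).
- exact: (C5_common D).
- exact: (C5_common E).
- exact: (C5_common F).
- exact: (C5_common C).
Qed.

Lemma C5_dom v1 v2 v3 v4 v5 x : C5 v1 v2 v3 v4 v5 ->
  [|| nb x v1, nb x v2, nb x v3, nb x v4 | nb x v5].
Proof.
move/C5_dominating/setP/(_ x); rewrite !inE.
by case: (nb x v1) (nb x v2) (nb x v3) (nb x v4) (nb x v5) => [] [] [] [] [].
Qed.

(** In the three [conflict] names, [T] is a vertex attached to one vertex of the cycle and [E] one
    attached to an edge. If [t] and [x] are nonadjacent, [t v1 v5 v4 v3 x] is a [P_6]; if adjacent,
    they close a [C_6], or a [C_4] in the mixed case. *)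
Lemma conflict_TT v1 v2 v3 v4 v5 t x : C5 v1 v2 v3 v4 v5 ->
    pat v1 v2 v3 v4 v5 t true false false false false ->
  ~~ [&& ~~ nb x v1, ~~ nb x v2, nb x v3, ~~ nb x v4 & ~~ nb x v5].
Proof.
case=> ? ? ? ? ? ? ? ? ? ? [? ? ? ? ?].
apply/negP=> /and5P[/negbTE? /negbTE? ? /negbTE? /negbTE?].
have [tx|/negbTE tx] := boolP (nb t x).
  by apply: (h6 (a := t) (b := v1) (c := v5) (d := v4) (e := v3) (f := x)); nbs.
by apply: (hP (a := t) (b := v1) (c := v5) (d := v4) (e := v3) (f := x)); nbs.
Qed.

Lemma conflict_TE v1 v2 v3 v4 v5 t x : C5 v1 v2 v3 v4 v5 ->
    pat v1 v2 v3 v4 v5 t true false false false false ->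
  ~~ [&& ~~ nb x v1, nb x v2, nb x v3, ~~ nb x v4 & ~~ nb x v5].
Proof.
case=> ? ? ? ? ? ? ? ? ? ? [? ? ? ? ?].
apply/negP=> /and5P[/negbTE? ? ? /negbTE? /negbTE?].
have [tx|/negbTE tx] := boolP (nb t x).
  by apply: (h4 (a := t) (b := v1) (c := v2) (d := x)); nbs.
by apply: (hP (a := t) (b := v1) (c := v5) (d := v4) (e := v3) (f := x)); nbs.
Qed.

Lemma conflict_EE v1 v2 v3 v4 v5 t x : C5 v1 v2 v3 v4 v5 ->
    pat v1 v2 v3 v4 v5 t true true false false false ->
  ~~ [&& ~~ nb x v1, nb x v2, nb x v3, ~~ nb x v4 & ~~ nb x v5].
Proof.
case=> ? ? ? ? ? ? ? ? ? ? [? ? ? ? ?].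
apply/negP=> /and5P[/negbTE? ? ? /negbTE? /negbTE?].
have [tx|/negbTE tx] := boolP (nb t x).
  by apply: (h6 (a := t) (b := v1) (c := v5) (d := v4) (e := v3) (f := x)); nbs.
by apply: (hP (a := t) (b := v1) (c := v5) (d := v4) (e := v3) (f := x)); nbs.
Qed.

End FiveCycle.

(** * Nonneighbours of the apex of a pyramid *)

Section PyramidStructure.
Variables (k : nat) (G : sgraph).
Hypothesis Gk : critical k G.
Implicit Types (a c d e : G).

Lemma pyramid_rot (a a1 a2 a3 c1 c2 c3 : G) :
  pyramid a a1 a2 a3 c1 c2 c3 -> pyramid a a2 a3 a1 c2 c3 c1.
Proof. by case=> *; split; nbs. Qed.

Lemma pyramid_swap (a a1 a2 a3 c1 c2 c3 : G) :
  pyramid a a1 a2 a3 c1 c2 c3 -> pyramid a a1 a3 a2 c1 c3 c2.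
Proof. by case=> *; split; nbs. Qed.

Lemma pyramid_C5 (a a1 a2 a3 c1 c2 c3 : G) :
  pyramid a a1 a2 a3 c1 c2 c3 ->
  C5 a a1 c1 c2 a2 /\ pat a a1 c1 c2 a2 a3 true false false false false.
Proof. by case=> *; split; split; try nbs; rewrite nb_sym. Qed.

(** Any two of the three paths from the apex lie on a five-cycle to which the third neighbour of the
    apex is attached at [a] only. Domination, arcs and conflicts for these three cycles rule out
    every trace of [d] that misses [c1]. *)
Lemma pyramid_base (a a1 a2 a3 c1 c2 c3 d : G) :
  pyramid a a1 a2 a3 c1 c2 c3 -> nb d a = false -> nb d c1.
Proof.
move=> H da.
have [C ta] := pyramid_C5 H.
have [D tb] := pyramid_C5 (pyramid_swap H).
have [E tc] := pyramid_C5 (pyramid_rot H).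
have := C5_dom Gk d C; have := C5_dom Gk d D; have := C5_dom Gk d E.
have := conflict_TT Gk d C ta; have := conflict_TT Gk d (C5_rev C) (pat_rev ta).
have := conflict_TE Gk d C ta; have := conflict_TE Gk d (C5_rev C) (pat_rev ta).
have := conflict_TT Gk d D tb; have := conflict_TT Gk d (C5_rev D) (pat_rev tb).
have := conflict_TE Gk d D tb; have := conflict_TE Gk d (C5_rev D) (pat_rev tb).
have := conflict_TT Gk d E tc; have := conflict_TT Gk d (C5_rev E) (pat_rev tc).
have := conflict_TE Gk d E tc; have := conflict_TE Gk d (C5_rev E) (pat_rev tc).
have := C5_arc Gk d (C5_rot (C5_rot (C5_rot (C5_rot C)))).
have := C5_arc Gk d (C5_rot (C5_rot (C5_rot (C5_rot D)))).
have := C5_arc Gk d (C5_rot (C5_rot (C5_rot (C5_rot E)))).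
have := C5_arc Gk d (C5_rot C); have := C5_arc Gk d (C5_rot (C5_rot C)).
have := C5_arc Gk d (C5_rot D); have := C5_arc Gk d (C5_rot (C5_rot D)).
have := C5_arc Gk d (C5_rot E); have := C5_arc Gk d (C5_rot (C5_rot E)).
rewrite da; move: (nb d a1) (nb d a2) (nb d a3) (nb d c1) (nb d c2) (nb d c3).
by do 6!case.
Qed.

Lemma pyramid_leg (a a1 a2 a3 c1 c2 c3 d : G) :
  pyramid a a1 a2 a3 c1 c2 c3 -> nb d a = false -> nb d a1 -> nb d a2 = false.
Proof.
move=> H da d1; have [C _] := pyramid_C5 H.
have := C5_arc Gk d (C5_rot (C5_rot (C5_rot (C5_rot C)))).
by rewrite da d1 andbT implybF => /negbTE.
Qed.

(* [d] may replace [c1] in the pyramid. *)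
Lemma pyramid_complete (a a1 a2 a3 c1 c2 c3 d e : G) :
  pyramid a a1 a2 a3 c1 c2 c3 -> nb d a = false -> nb d a1 -> nb e a = false ->
  nb d e.
Proof.
move=> H da d1 ea; rewrite nb_sym.
have d2 := pyramid_leg H da d1; have d3 := pyramid_leg (pyramid_swap H) da d1.
have dc2 := pyramid_base (pyramid_rot H) da.
have dc3 := pyramid_base (pyramid_rot (pyramid_rot H)) da.
apply: (pyramid_base (a := a) (a1 := a1) (a2 := a2) (a3 := a3) (c2 := c2)
  (c3 := c3)) => //.
by case: H => *; split; nbs.
Qed.

End PyramidStructure.

(** * Colouring around a pyramid *)

Lemma card_seq_set (T : finType) (s : seq T) (X Y : {set T}) :
    uniq s -> all (fun x => (x \in Y) && (x \notin X)) s -> X \subset Y ->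
  size s + #|X| <= #|Y|.
Proof.
move=> us /allP sY XY; rewrite -(card_uniqP us) -(cardsE (mem s)).
have <- : #|[set x in s] :|: X| = #|[set x in s]| + #|X|.
  rewrite cardsU disjoint_setI0 ?cards0 ?subn0 //.
  by rewrite disjoint_subset; apply/subsetP=> x; rewrite !inE => /sY/andP[].
apply: subset_leq_card; rewrite subUset XY andbT.
by apply/subsetP=> x; rewrite inE => /sY/andP[].
Qed.

Section PyramidColoring.
Variables (k : nat) (G : sgraph).
Hypotheses (Gk : critical k G) (k8 : 8 <= k).
Implicit Types (a c d e s u x y : G) (X : {set G}) (phi : G -> nat).

Let h4 := critical_noC4 Gk.

Definition near a := [set s | nb s a].
Definition far a := [set d | ~~ nb d a].

(** The colours lost to every vertex of [X], that is, the complement of the union of the lists to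
    which Hall's theorem is applied. *)
Definition blocked phi a X : {set 'I_k} :=
  [set i : 'I_k | [forall d in X, [exists s in near a, nb s d && (phi s == i)]]].

Lemma near_degree a : #|near a| <= k.+2.
Proof.
apply: leq_trans (critical_degree Gk a); apply/eq_leq/eq_card => x.
by rewrite !inE nb_sym.
Qed.

Lemma degree_count u (s : seq G) X : uniq s ->
    all (fun y => nb u y && (y \notin X)) s -> {in X, forall y, nb u y} ->
  size s + #|X| <= k.+2.
Proof.
move=> us sX uX; apply: leq_trans (critical_degree Gk u).
apply: card_seq_set => //; first by apply: sub_all sX => y; rewrite inE.
by apply/subsetP=> y /uX; rewrite inE.
Qed.

Lemma near_common a d s u : s \in near a -> u \in near a -> d \in far a ->
  nb s d -> nb u d -> nb s u.
Proof.
rewrite !inE => ? ? /negbTE ? ? ?; apply: contraT => /negbTE ?; exfalso.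
by apply: (h4 (a := a) (b := s) (c := d) (d := u)); nbs.
Qed.

Lemma near_leg a b d s : s \in near a -> b \in near a -> d \in far a ->
  nb d b -> nb s d -> nb s b.
Proof. by move=> sN bN dF db sd; apply: (near_common sN bN dF sd); rewrite nb_sym. Qed.

Lemma far_degree a d : nb_clique (far a) -> d \in far a ->
  #|[set s in near a | nb s d]| + #|far a| <= k.+2.
Proof.
move=> cl dF; apply: leq_trans (critical_degree Gk d).
have <- : #|[set s in near a | nb s d] :|: far a| =
    #|[set s in near a | nb s d]| + #|far a|.
  rewrite cardsU disjoint_setI0 ?cards0 ?subn0 //.
  by rewrite disjoint_subset; apply/subsetP=> x; rewrite !inE negbK => /andP[].
apply/subset_leq_card/subsetP=> x; rewrite 2!inE [x \in [set y | _]]inE.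
by rewrite nb_sym => /orP[/andP[_]|/(cl _ _ dF)//]; rewrite nb_sym.
Qed.

Lemma blocked_leq phi a X d : d \in X ->
  #|blocked phi a X| <= #|[set s in near a | nb s d]|.
Proof.
move=> dX; have k0 : 0 < k by lia.
pose f s : 'I_k := insubd (Ordinal k0) (phi s).
apply: leq_trans (leq_imset_card f _); apply/subset_leq_card/subsetP=> i.
rewrite inE => /forall_inP/(_ d dX)/exists_inP[s sN /andP[sd /eqP si]].
apply/imsetP; exists s; first by rewrite inE sN.
by rewrite /f; apply: val_inj; rewrite val_insubd si ltn_ord.
Qed.

(* The obstruction provided by Hall's theorem; sets missing two or more
   vertices of [far a] are never deficient, by the degree bound. *)
Lemma deficient phi a : nb_clique (far a) -> proper_on k phi (near a) ->
  exists X, [/\ X \subset far a, #|far a| <= #|X|.+1 & k < #|X| + #|blocked phi a X|].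
Proof.
move=> cl [phik phiP].
have [/existsP[X /and3P[]]|noX] := boolP [exists X : {set G}, [&& X \subset far a,
  #|far a| <= #|X|.+1 & k < #|X| + #|blocked phi a X|]]; first by exists X.
have k0 : 0 < k by lia.
pose L d := [set i : 'I_k | ~~ [exists s in near a, nb s d && (phi s == i)]].
have bigL X : \bigcup_(d in X) L d = ~: blocked phi a X.
  apply/setP=> i; rewrite !inE negb_forall_in.
  apply/bigcupP/exists_inP => -[d dX di]; exists d => //.
    by move: di; rewrite inE.
  by rewrite inE.
have [|f [fL fI]] := @hall _ _ (Ordinal k0) L (far a).
  move=> X XF; rewrite bigL; have := cardsC (blocked phi a X); rewrite card_ord.
  have [->|[d dX]] := set_0Vmem X; first by rewrite cards0.
  have [lt|ge] := leqP #|far a| #|X|.+1.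
    move: noX; rewrite negb_exists => /forallP/(_ X); rewrite XF lt /= -leqNgt.
    by move: #|blocked phi a X| #|~: blocked phi a X| => b b' *; lia.
  have := blocked_leq phi a dX; have := far_degree cl (subsetP XF _ dX).
  by move: #|blocked phi a X| #|~: blocked phi a X| => b b' *; lia.
case: (critical_not_kcol Gk).
have Ff x : x \in near a = false -> x \in far a by rewrite !inE => ->.
have fk x s : x \in near a = false -> s \in near a -> adj s x -> phi s <> f x.
  move=> /Ff/fL; rewrite inE negb_exists => /forallP/(_ s) + sN sx e.
  by rewrite sN adj_nb //= e eqxx.
exists (fun x => if x \in near a then phi x else f x); split=> [x _|x y _ _].
  by case: ifP => [/phik|_ ].
case: ifP => xN; case: ifP => yN.
- exact: phiP.
- exact: fk.
- by rewrite adj_sym => /fk h; apply/nesym/h.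
- by move=> xy /val_inj/fI e; rewrite e ?Ff // adj_irrefl in xy.
Qed.

Variables a a1 a2 a3 c1 c2 c3 : G.
Hypothesis H : pyramid a a1 a2 a3 c1 c2 c3.

Lemma pyramid_near : [/\ a \in near a, a1 \in near a, a2 \in near a & a3 \in near a].
Proof. by case: H => *; split; rewrite inE; nbs. Qed.

Lemma pyramid_far : [/\ c1 \in far a, c2 \in far a & c3 \in far a].
Proof. by case: H => *; split; rewrite inE nb_sym; apply/negbT. Qed.

Lemma pyramid_uniq : uniq [:: a; a1; a2; a3].
Proof.
have ne (x y z : G) : nb x z = false -> nb y z -> x != y.
  by move=> xz yz; apply: contraTneq yz => <-; rewrite xz.
case: H => *; rewrite /= !inE !negb_or !andbT.
by rewrite (ne a a1 c1) ?(ne a a2 c2) ?(ne a a3 c3) ?(ne a1 a2 c2) ?(ne a1 a3 c3)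
  ?(ne a2 a3 c3).
Qed.

(** Marks the three neighbours of the apex [a] in the pyramid, its legs, and not [a] itself. *)
Let apex s := s \in [:: a1; a2; a3].

Lemma apex_near s : apex s -> s \in near a.
Proof.
have [_ ? ? ?] := pyramid_near; rewrite /apex !in_cons in_nil orbF.
by case/or3P=> /eqP->.
Qed.

Lemma apex_nonadj s u : apex s -> apex u -> adj s u = false.
Proof.
rewrite /apex !in_cons in_nil !orbF.
have [_ _ _ _ _ _ _ _ _ _ _ _ n12 n23 n31 _ _ _ _ _ _] := H.
have /nb_false_adj m12 := n12; have /nb_false_adj m23 := n23.
have /nb_false_adj m31 := n31.
by case/or3P=> /eqP-> /or3P[]/eqP->; rewrite ?adj_irrefl // adj_sym.
Qed.

(** One colour for the three legs saves two among the at most [k + 2] vertices of [near a]. *)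
Lemma triple_coloring : exists phi,
  [/\ proper_on k phi (near a), {in apex &, forall s u, phi s = phi u} &
    {in near a &, forall s u, phi s = phi u -> s <> u -> apex s /\ apex u}].
Proof.
have [na n1 n2 n3] := pyramid_near; have := pyramid_uniq.
rewrite /= !inE !negb_or => /and4P[/and3P[? ? ?] /andP[a12 a13] a23 _].
pose r s := if apex s then a1 else s.
have r1 x : x \notin apex -> x != a1.
  by apply: contraNneq => ->; rewrite /apex unfold_in mem_head.
have rE x y : r x = r y -> x = y \/ apex x /\ apex y.
  rewrite /r; case: ifPn => xA; case: ifPn => yA; auto.
  - by move=> e; have := r1 y yA; rewrite e eqxx.
  - by move=> e; have := r1 x xA; rewrite e eqxx.
have [|||phi phiP phiE] := @retract_coloring G k (near a) (near a :\ a2 :\ a3) r.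
- have := near_degree a; rewrite (cardsD1 a2) n2 (cardsD1 a3) !inE eq_sym a23 /=.
  by rewrite inE in n3; rewrite n3; lia.
- move=> x xN; rewrite /r /apex; case: ifPn => [_|].
    by rewrite in_setD1 in_setD1 n1 a12 a13.
  by rewrite !inE !negb_or => /and3P[_ -> ->]; rewrite inE in xN.
- by move=> x y _ _ /rE[->|[]]; [rewrite adj_irrefl | apply: apex_nonadj].
exists phi; split=> // s u.
  by move=> sA uA; apply/phiE; rewrite ?apex_near // /r ifT ?ifT.
by move=> sN uN /phiE-/(_ sN uN) /rE[|//] ->.
Qed.

Lemma apex_complete b d e : apex b -> d \in far a -> e \in far a -> nb d b -> nb d e.
Proof.
rewrite /apex !in_cons in_nil orbF !inE => bA /negbTE da /negbTE ea.
have H' := pyramid_rot H; have H'' := pyramid_rot H'.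
by case/or3P: bA => /eqP-> db;
  [exact: (pyramid_complete Gk H da db ea) | exact: (pyramid_complete Gk H' da db ea)
  | exact: (pyramid_complete Gk H'' da db ea)].
Qed.

Lemma far_base d : d \in far a -> [/\ nb d c1, nb d c2 & nb d c3].
Proof.
rewrite inE => /negbTE da; have H' := pyramid_rot H; have H'' := pyramid_rot H'.
by split; [exact: (pyramid_base Gk H da) | exact: (pyramid_base Gk H' da)
  | exact: (pyramid_base Gk H'' da)].
Qed.

Lemma base_uniq : uniq [:: c1; c2; c3].
Proof.
have [_ _ _ n1 n2 n3 _ _ _ _ _ _ _ _ _ n12 n13 _ n23 _ _] := H.
have ne (x y z : G) : nb z x -> nb z y = false -> x != y.
  by move=> xz yz; apply: contraTneq xz => ->; rewrite yz.
by rewrite /= !inE negb_or andbT (ne c1 c2 a1) // (ne c1 c3 a1) // (ne c2 c3 a2).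
Qed.

Lemma base_apex c : c \in [:: c1; c2; c3] -> exists2 b, apex b & nb c b.
Proof.
have [_ _ _ n1 n2 n3 _ _ _ _ _ _ _ _ _ _ _ _ _ _ _] := H.
rewrite !in_cons in_nil orbF => /or3P[]/eqP->;
  [exists a1 | exists a2 | exists a3]; rewrite ?(nb_sym c1) ?(nb_sym c2) ?(nb_sym c3) //;
  by rewrite /apex !inE eqxx ?orbT.
Qed.

Lemma base_far c : c \in [:: c1; c2; c3] -> c \in far a.
Proof.
have [? ? ?] := pyramid_far.
by rewrite !in_cons in_nil orbF => /or3P[]/eqP->.
Qed.

Lemma near_far x : (x \in near a) = (x \notin far a).
Proof. by rewrite !inE negbK. Qed.

(* Two nonadjacent vertices [m], [m'] of [far a] are not adjacent to the apex
   vertices, so they may receive the colour of these. The other vertices with no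
   apex neighbour are coloured before their neighbours [c1], [c2], [c3]; each
   remaining vertex sees this colour three times. *)
Lemma far_clique : nb_clique (far a).
Proof.
move=> m m' mF m'F; apply: contraT => /negbTE mm'; exfalso.
have mA b : apex b -> nb m b = false.
  by move=> bA; apply: contraFF mm' => /(apex_complete bA mF m'F).
have m'A b : apex b -> nb m' b = false.
  by move=> bA; apply: contraFF mm' => /(apex_complete bA m'F mF); rewrite nb_sym.
have [phi [[phik phiP] phiA phiE]] := triple_coloring.
have A1 : apex a1 by rewrite /apex mem_head.
have n1 := apex_near A1.
have phig x : x \in near a -> phi x = phi a1 -> apex x.
  by case: (x =P a1) => [->//|x1 xN e]; have [] := phiE _ _ xN n1 e x1.
pose A := near a :|: [set m; m'].
pose c x := if x \in near a then phi x else phi a1.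
have MF x : x \in [set m; m'] -> x \in far a by rewrite !in_set2 => /orP[]/eqP->.
have MA x b : x \in [set m; m'] -> apex b -> nb x b = false.
  by rewrite !in_set2 => /orP[]/eqP->; [apply: mA | apply: m'A].
have cM x : x \in [set m; m'] -> c x = phi a1.
  by move/MF => xF; rewrite /c near_far xF.
have cP : proper_on k c A.
  split=> [x _|x y]; first by rewrite /c; case: ifP => [xN|_]; apply: phik.
  rewrite /c /A (in_setU x) (in_setU y); case: ifP => xN; case: ifP => yN //= xA yA xy.
  - exact: phiP.
  - move=> /(phig _ xN) /(MA y x yA); rewrite nb_sym => /nb_false_adj.
    by rewrite xy.
  - by move=> /esym/(phig _ yN) /(MA x y xA) /nb_false_adj; rewrite xy.
  - have /nb_false_adj m0 := mm'; move: xA yA xy.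
    by rewrite !in_set2 => /orP[]/eqP-> /orP[]/eqP->; rewrite ?adj_irrefl ?m0 // adj_sym m0.
pose M := [set x in far a | [forall b, apex b ==> ~~ nb x b]].
(* Four members of the closed neighbourhood of [x] are exempt from the count, which leaves the
   [k + 2 - 4 = k - 2] that greedy colouring allows. *)
have count x (X : {set G}) (s : seq G) : size s = 4 -> uniq s ->
    all (fun y => nb x y && (y \notin X)) s -> {in X, forall y, nb x y} ->
    #|X| <= k - 2.
  by move=> s4 us sX XN; have := degree_count us sX XN; rewrite s4; lia.
have k1 : 1 < k by lia.
have [|c' c'P c'E] := @greedy_extension _ _ c A M (phi a1) k1 cP.
  move=> x; rewrite inE => /andP[xF /forall_inP xA].
  have bnot b : b \in [:: c1; c2; c3] -> b \notin A :|: M.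
    move=> bc; have bF := base_far bc; have [p pA bp] := base_apex bc.
    rewrite in_setU (in_setU b) near_far bF /= negb_or; apply/andP; split.
      by apply/negP=> bM; rewrite (MA _ _ bM pA) in bp.
    by rewrite inE bF /=; apply/negP=> /forall_inP/(_ p pA); rewrite bp.
  apply: (count x _ [:: x; c1; c2; c3]) => //.
  - rewrite cons_uniq base_uniq andbT; apply/negP=> /base_apex[b /xA].
    by move=> + xb; rewrite xb.
  - have [? ? ?] := far_base xF; apply/allP=> y; rewrite in_cons => /predU1P[->|yc].
      by rewrite nb_refl inE adj_irrefl andbF.
    rewrite inE (negbTE (bnot y yc)) /= andbT; move: yc.
    by rewrite !in_cons in_nil orbF => /or3P[]/eqP->.
  - by move=> y; rewrite inE => /and3P[_ /adj_nb].
have [|d dP _] := @greedy_extension _ _ c' (A :|: M) (~: (A :|: M)) (phi a1) k1 c'P.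
  move=> x; rewrite in_setC in_setU negb_or in_setU negb_or => /andP[/andP[xN xm] xM].
  have xF : x \in far a by rewrite near_far negbK in xN.
  move: xM; rewrite inE xF /= negb_forall => /existsP[b].
  rewrite negb_imply negbK => /andP[bA xb].
  have bN := apex_near bA.
  have notX y : y \in A -> c y = phi a1 -> y \notin
    [set y in A :|: M :|: ~: (A :|: M) | adj x y && ~~ ((y \in A :|: M) && (c' y == phi a1))].
    by move=> yA cy; rewrite inE [y \in A :|: M]inE yA /= c'E // cy eqxx !andbF.
  have mA' y : y \in [set m; m'] -> y \in A by move=> yM; rewrite inE yM orbT.
  apply: (count x _ [:: x; b; m; m']) => //.
  - rewrite in_set2 negb_or in xm; case/andP: xm => xm xm'.
    rewrite /= !inE !negb_or xm xm' (nb_false_neq mm') !andbT.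
    rewrite near_far in bN; apply/and3P; split.
    + by apply: contraNneq bN => <-.
    + by apply: contraNneq bN => ->.
    + by apply: contraNneq bN => ->.
  - have nm := apex_complete bA xF mF xb; have nm' := apex_complete bA xF m'F xb.
    have nX y : y \in [set m; m'] -> y \notin _ := fun yM => notX y (mA' y yM) (cM y yM).
    apply/and5P; split=> //; rewrite ?nb_refl ?xb ?nm ?nm' /=.
    + by rewrite inE adj_irrefl andbF.
    + by apply: notX; [rewrite in_setU bN | rewrite /c bN; apply: phiA].
    + by apply: nX; rewrite set21.
    + by apply: nX; rewrite set22.
  - by move=> y; rewrite inE => /and3P[_ /adj_nb].
by case: (critical_not_kcol Gk); exists d; rewrite -(setUCr (A :|: M)).
Qed.

End PyramidColoring.

(** * The tight case of Hall's condition *)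

Section Tight.
Variables (k : nat) (G : sgraph).
Hypotheses (Gk : critical k G) (k8 : 8 <= k).
Implicit Types (c d e s u x y : G) (X : {set G}) (phi : G -> nat).
Variables a a1 a2 a3 c1 c2 c3 : G.
Hypothesis H : pyramid a a1 a2 a3 c1 c2 c3.

(* A deficient set [X] for a colouring that repeats only the colour of the apex
   vertices forms, with its common neighbours in [near a], a clique of order [k];
   a common neighbour would have too large a degree. *)
Lemma far_tight : [/\ #|far a| = k,
  {in far a, forall d, [\/ nb d a1, nb d a2 | nb d a3]} &
  {in near a, forall s, exists2 d, d \in far a & nb s d = false}].
Proof.
have cl := far_clique Gk k8 H; have [phi [phiP phiA phiE]] := triple_coloring Gk k8 H.
have [X [XF FX Xk]] := deficient Gk k8 cl phiP.
have [na n1 n2 n3] := pyramid_near H; have [f1 f2 f3] := pyramid_far H.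
have [_ _ _ e1 e2 e3 _ _ _ ac1 ac2 ac3 n12 n23 n31 n1c2 n1c3 n2c1 n2c3 n3c1 n3c2] := H.
have A1 : a1 \in [:: a1; a2; a3] by rewrite mem_head.
have one c c' : c \in far a -> c' \in far a -> c != c' -> c \in X \/ c' \in X.
  move=> cF c'F cc'; apply/orP; apply: contraT; rewrite negb_or => /andP[cX c'X].
  have us : uniq [:: c; c'] by rewrite /= inE cc'.
  have sX : all (fun x => (x \in far a) && (x \notin X)) [:: c; c'].
    by rewrite /= cF c'F cX c'X.
  by have /= := card_seq_set us sX XF; move: FX; clear; lia.
have [c12 c13 c23] : [/\ c1 != c2, c1 != c3 & c2 != c3].
  by have := base_uniq H; rewrite /= !inE negb_or andbT => /andP[/andP[]].
have [d0 d0X] : exists d0, d0 \in X by case: (one _ _ f1 f2 c12); [exists c1 | exists c2].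
pose K := [set s in near a | [forall d in X, nb s d]].
have k0 : 0 < k by move: k8; clear; lia.
pose f s : 'I_k := insubd (Ordinal k0) (phi s).
have fE s (i : 'I_k) : phi s = i -> f s = i.
  by move=> si; apply: val_inj; rewrite val_insubd si ltn_ord.
(* A colour other than that of the legs belongs to one vertex only; if it is blocked, this vertex is
   adjacent to all of [X]. *)
have sub : blocked k phi a X \subset f a1 |: [set f s | s in K].
  apply/subsetP=> i; rewrite inE => /forall_inP iX; rewrite in_setU1.
  have [s sN /andP[sd /eqP si]] := exists_inP (iX d0 d0X).
  case: (altP (i =P f a1)) => //= ia; apply/imsetP; exists s; last by rewrite (fE s i).
  rewrite inE sN; apply/forall_inP=> d /iX/exists_inP[u uN /andP[ud /eqP ui]].
  case: (altP (s =P u)) => [->//|/eqP su].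
  have [|sA uA] := phiE s u sN uN _ su; first by rewrite si ui.
  by case/eqP: ia; rewrite -(fE s i si) /f (phiA s a1).
have Kcard : #|blocked k phi a X| <= (f a1 \in blocked k phi a X) + #|K|.
  have fK := leq_imset_card f K; case: (boolP (f a1 \in _)) => [_|fa].
    apply: leq_trans (subset_leq_card sub) _; rewrite cardsU1.
    by apply: leq_add fK; apply: leq_b1.
  apply: leq_trans fK; apply/subset_leq_card/subsetP=> i iB.
  have := subsetP sub i iB; rewrite in_setU1 => /predU1P[e|//].
  by rewrite -e iB in fa.
have KX s d : s \in K -> d \in X -> nb s d.
  by rewrite inE => /andP[_ /forall_inP]; apply.
have KN s : s \in K -> s \in near a by rewrite inE => /andP[].
have dis : #|X :|: K| = #|X| + #|K|.
  rewrite cardsU disjoint_setI0 ?cards0 ?subn0 // disjoint_sym disjoint_subset.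
  apply/subsetP=> s /KN; rewrite near_far; apply: contraNN; exact: (subsetP XF).
have XK : nb_clique (X :|: K).
  move=> x y; rewrite !in_setU => /orP[xX|xK] /orP[yX|yK].
  - by apply: cl; apply: (subsetP XF).
  - by rewrite nb_sym KX.
  - exact: KX.
  - by apply: (near_common Gk (KN _ xK) (KN _ yK) (subsetP XF _ d0X)); apply: KX.
have XKk := critical_clique Gk XK; rewrite dis in XKk.
(* More than [k - #|X|] colours are blocked, at most one of them without a vertex of [K], while the
   clique [X :|: K] has at most [k] vertices. So equality holds and the colour of the legs is
   blocked. *)
have [fa XKe] : f a1 \in blocked k phi a X /\ #|X| + #|K| = k.
  move: Kcard Xk XKk; case: (f a1 \in _);
    by move: #|blocked k phi a X| => b; clear => /= *; first split=> //; lia.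
(* A vertex of [K] would have [k + 3] closed neighbours: the clique [X :|: K] of order [k], and [a],
   [b], [b'] outside it. *)
have Kempty (b c b' c' : G) : b \in near a -> b' \in near a -> c \in X -> c' \in X ->
    nb b c -> nb b' c' -> nb b c' = false -> nb b' c = false -> nb a c = false ->
    nb a c' = false -> K = set0.
  move=> bN b'N cX c'X bc b'c' bc' b'c ac ac'; apply/eqP; apply: contraT => /set0Pn[u uK].
  have uN := KN _ uK.
  have ub : nb u b.
    by apply: (near_leg Gk uN bN (subsetP XF _ cX)); rewrite 1?nb_sym // nb_sym KX.
  have ub' : nb u b'.
    by apply: (near_leg Gk uN b'N (subsetP XF _ c'X)); rewrite 1?nb_sym // nb_sym KX.
  have ua : nb u a by rewrite inE in uN.
  have nX x d : x \in near a -> d \in X -> nb x d = false -> x \notin X :|: K.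
    move=> xN dX xd; rewrite in_setU negb_or; apply/andP; split.
      by rewrite near_far in xN; apply: contraNN xN; apply: (subsetP XF).
    by apply/negP=> /KX/(_ dX); rewrite xd.
  have us : uniq [:: a; b; b'].
    rewrite /= !inE negb_or andbT; apply/andP; split; first apply/andP; first split.
    - by apply: contraFneq ac => ->.
    - by apply: contraFneq ac' => ->.
    - by apply: contraFneq b'c => <-.
  have sX : all (fun y => nb u y && (y \notin X :|: K)) [:: a; b; b'].
    by rewrite /= ua ub ub' (nX a c) // (nX b c') // (nX b' c).
  have uX : {in X :|: K, forall y, nb u y}.
    by move=> y yX; apply: XK => //; rewrite in_setU uK orbT.
  by have /= := degree_count Gk us sX uX; rewrite dis XKe; clear; lia.
have K0 : K = set0.
  have [x1|x2] := one _ _ f1 f2 c12.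
    have [y2|y3] := one _ _ f2 f3 c23; first exact: (Kempty a1 c1 a2 c2).
    by apply: (Kempty a1 c1 a3 c3).
  have [y1|y3] := one _ _ f1 f3 c13; first exact: (Kempty a1 c1 a2 c2).
  by apply: (Kempty a2 c2 a3 c3).
have Xe : X = far a.
  apply/eqP; rewrite eqEcard XF; have := critical_clique Gk cl.
  by rewrite -XKe K0 cards0 addn0.
split.
- by rewrite -XKe K0 cards0 addn0 Xe.
- move=> d; rewrite -Xe => dX; move: fa; rewrite inE => /forall_inP/(_ d dX).
  case/exists_inP=> s sN /andP[sd /eqP si].
  have : s \in [:: a1; a2; a3].
    case: (altP (s =P a1)) => [->//|/eqP s1].
    have [|//] := phiE s a1 sN n1 _ s1.
    by rewrite si /f val_insubd; case: phiP => /(_ a1 n1) ->.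
  rewrite !in_cons in_nil orbF !(nb_sym d).
  by case/or3P=> /eqP<-; [constructor 1 | constructor 2 | constructor 3].
- move=> s sN; have : s \notin K by rewrite K0 inE.
  rewrite inE sN negb_forall => /existsP[d].
  by rewrite negb_imply Xe => /andP[dF /negbTE sd]; exists d.
Qed.
End Tight.

(** * The second colouring, by two pairs *)

Section PairColoring.
Variables (k : nat) (G : sgraph).
Hypotheses (Gk : critical k G) (k8 : 8 <= k).
Implicit Types (c d e s u x y : G) (X : {set G}) (phi : G -> nat).

(** Otherwise [s a1 e d2] is a four-cycle. By symmetry, a vertex of [near a] that sees vertices of
    two leg classes sees both classes entirely. *)
Lemma cross a a1 a2 a3 c1 c2 c3 s d1 d2 e : pyramid a a1 a2 a3 c1 c2 c3 ->
  s \in near a -> d1 \in far a -> d2 \in far a -> e \in far a ->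
  nb d1 a1 -> nb d2 a2 -> nb e a1 -> nb s d1 -> nb s d2 -> nb s e.
Proof.
move=> H sN d1F d2F eF d11 d22 e1 sd1 sd2.
have [_ n1 _ _] := pyramid_near H.
have s1 := near_leg Gk sN n1 d1F d11 sd1.
move: eF d2F; rewrite !inE => /negbTE ea /negbTE d2a.
have ed2 := pyramid_complete Gk H ea e1 d2a.
have d21 := pyramid_leg Gk (pyramid_swap (pyramid_rot H)) d2a d22.
apply: contraT => /negbTE se; exfalso.
by apply: (critical_noC4 Gk (a := s) (b := a1) (c := e) (d := d2)); nbs.
Qed.

(** Coincidences of colours are only confined to the two pairs. The vertex [x] may be [a1] itself,
    which leaves the single pair [a2], [a3]. *)
Definition pair_coloring phi a a1 a2 a3 x := proper_on k phi (near a) /\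
  {in near a &, forall s u, phi s = phi u -> s != u ->
    (s \in [:: a2; a3]) && (u \in [:: a2; a3]) ||
    (s \in [:: a1; x]) && (u \in [:: a1; x])}.

Lemma pair_coloring_exists a a1 a2 a3 c1 c2 c3 x : pyramid a a1 a2 a3 c1 c2 c3 ->
    x \notin [:: a2; a3] -> adj x a1 = false ->
    #|[set s in near a | (s != a3) && ((s == a1) || (s != x))]| <= k ->
  exists phi, pair_coloring phi a a1 a2 a3 x.
Proof.
move=> H xN xa1 Bk; have [_ n1 n2 n3] := pyramid_near H.
have := pyramid_uniq H; rewrite /= !inE !negb_or.
case/and4P=> /and3P[aa1 aa2 aa3] /andP[a12 a13] a23 _.
pose r s := if s == a3 then a2 else if s == x then a1 else s.
have rE s u : r s = r u -> s = u \/
    (s \in [:: a2; a3]) && (u \in [:: a2; a3]) ||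
    (s \in [:: a1; x]) && (u \in [:: a1; x]).
  rewrite /r !inE; move: xN; rewrite !inE negb_or => /andP[xa2 xa3].
  case: (altP (s =P a3)) => [->|s3]; case: (altP (u =P a3)) => [->|u3] //=;
    rewrite ?eqxx ?orbT /=; auto.
  - case: (altP (u =P x)) => [->|ux] e; last by right; rewrite -e eqxx.
    by rewrite e eqxx in a12.
  - case: (altP (s =P x)) => [->|sx] e; last by right; rewrite e eqxx.
    by rewrite e eqxx in a12.
  case: (altP (s =P x)) => [->|sx]; case: (altP (u =P x)) => [->|ux] //= e;
    auto; right; by rewrite ?e -?e ?eqxx ?orbT.
have [||phi phiP phiE] := @retract_coloring G k (near a) _ r Bk.
- move=> s sN; rewrite inE /r; case: (altP (s =P a3)) => [_|s3].
    rewrite n2 a23 /=; apply/orP; right; apply: contraNneq xN => <-.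
    by rewrite mem_head.
  case: (altP (s =P x)) => [_|sx]; first by rewrite n1 a13 eqxx.
  by rewrite sN s3 sx orbT.
- have [_ _ _ _ _ _ _ _ _ _ _ _ _ n23 _ _ _ _ _ _ _] := H.
  have /nb_false_adj m23 := n23.
  move=> s u _ _ /rE[->|]; first by rewrite adj_irrefl.
  rewrite !inE => /orP[]/andP[]/orP[]/eqP-> /orP[]/eqP->;
    by rewrite ?adj_irrefl // adj_sym.
exists phi; split=> // s u sN uN /phiE-/(_ sN uN)/rE[->|//].
by rewrite eqxx.
Qed.

Lemma far_legs a a1 a2 a3 c1 c2 c3 d : pyramid a a1 a2 a3 c1 c2 c3 ->
  d \in far a -> nb d a1 -> nb d a2 = false /\ nb d a3 = false.
Proof.
rewrite inE => H /negbTE da d1.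
by have := pyramid_leg Gk H da d1; have := pyramid_leg Gk (pyramid_swap H) da d1.
Qed.

Lemma neighbour_neq s d u : nb s d -> nb d u = false -> s != u.
Proof. by move=> sd; apply: contraFneq => <-; rewrite nb_sym. Qed.

Section Blocked.
Variables (a a1 a2 a3 c1 c2 c3 x : G) (phi : G -> nat).
Hypotheses (H : pyramid a a1 a2 a3 c1 c2 c3)
  (phiP : pair_coloring phi a a1 a2 a3 x) (xA : x \notin [:: a2; a3]).

Lemma blockedE X i d : i \in blocked k phi a X -> d \in X ->
  exists s, [/\ s \in near a, nb s d & phi s = i].
Proof.
rewrite inE => /forall_inP iX /iX/exists_inP[s sN /andP[sd /eqP si]].
by exists s.
Qed.

(** By [cross] and the last hypothesis, [d1] and [d2] see the colour [i] at different vertices. As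
    [d1] sees neither [a2] nor [a3] and [d2] does not see [a1], these are [a1] and [x], in this
    order. *)
Lemma blocked12 X i d1 d2 : X \subset far a -> i \in blocked k phi a X ->
    d1 \in X -> d2 \in X -> nb d1 a1 -> nb d2 a2 ->
    {in near a, forall u, nb u c1 -> nb u c2 -> False} -> phi a1 = i.
Proof.
move=> XF iB d1X d2X d11 d22 U; have [c1F c2F _] := pyramid_far H.
have [_ _ _ e1 e2 _ _ _ _ _ _ _ _ _ _ _ _ _ _ _ _] := H.
have H' := pyramid_swap (pyramid_rot H).
have d1F := subsetP XF _ d1X; have d2F := subsetP XF _ d2X.
have [d12 d13] := far_legs H d1F d11; have [d21 d23] := far_legs H' d2F d22.
have [s1 [s1N s1d s1i]] := blockedE iB d1X.
have [s2 [s2N s2d s2i]] := blockedE iB d2X.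
have n12 := neighbour_neq s1d d12; have n13 := neighbour_neq s1d d13.
have n21 := neighbour_neq s2d d21.
have s12 : s1 != s2.
  apply/negP=> /eqP e; rewrite -e in s2d.
  case: (U s1 s1N); first by apply: (cross H s1N d1F d2F c1F d11 d22) => //; nbs.
  by apply: (cross H' s1N d2F d1F c2F d22 d11) => //; nbs.
have [_ /(_ _ _ s1N s2N _ s12)] := phiP; rewrite s1i s2i => /(_ erefl).
rewrite !inE (negbTE n12) (negbTE n13) (negbTE n21) /= => /andP[+ /eqP e].
by move: s12; rewrite e => /negbTE-> /[!orbF] /eqP <-.
Qed.

(** Again the colour is seen at two vertices; neither [d2] nor [d3] sees [a1], so the pair is [a2],
    [a3]. *)
Lemma blocked23 X i d2 d3 : X \subset far a -> i \in blocked k phi a X ->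
    d2 \in X -> d3 \in X -> nb d2 a2 -> nb d3 a3 ->
    {in near a, forall u, nb u c2 -> nb u c3 -> False} -> phi a2 = i.
Proof.
move=> XF iB d2X d3X d22 d33 U; have [_ c2F c3F] := pyramid_far H.
have [_ _ _ _ e2 e3 _ _ _ _ _ _ _ _ _ _ _ _ _ _ _] := H.
have H2 := pyramid_rot H; have H3 := pyramid_swap (pyramid_rot H2).
have d2F := subsetP XF _ d2X; have d3F := subsetP XF _ d3X.
have [d23 d21] := far_legs H2 d2F d22; have [d32 d31] := far_legs H3 d3F d33.
have [s2 [s2N s2d s2i]] := blockedE iB d2X.
have [s3 [s3N s3d s3i]] := blockedE iB d3X.
have n21 := neighbour_neq s2d d21; have n23 := neighbour_neq s2d d23.
have n31 := neighbour_neq s3d d31; have n32 := neighbour_neq s3d d32.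
have s23 : s2 != s3.
  apply/negP=> /eqP e; rewrite -e in s3d.
  case: (U s2 s2N); first by apply: (cross H2 s2N d2F d3F c2F d22 d33) => //; nbs.
  by apply: (cross H3 s2N d3F d2F c3F d33 d22) => //; nbs.
have [_ /(_ _ _ s2N s3N _ s23)] := phiP; rewrite s2i s3i => /(_ erefl).
rewrite !inE (negbTE n21) (negbTE n23) (negbTE n31) (negbTE n32) /= orbF.
case/orP=> [/andP[/eqP <-] //|/andP[/eqP e2x /eqP e3x]].
by rewrite e2x e3x eqxx in s23.
Qed.

(** One vertex showing a colour to [d1], [d2] and [d3] would by [cross] be complete to [far a].
    Otherwise [d1] sees the colour at [a1] and the other two see it at [x], which [cross] then makes
    adjacent to [c2] and [c3]. *)
Lemma blocked123 X d1 d2 d3 : X \subset far a ->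
    d1 \in X -> d2 \in X -> d3 \in X -> nb d1 a1 -> nb d2 a2 -> nb d3 a3 ->
    ~~ (nb x c2 && nb x c3) ->
    {in far a, forall d, [\/ nb d a1, nb d a2 | nb d a3]} ->
    {in near a, forall s, exists2 d, d \in far a & nb s d = false} ->
  blocked k phi a X = set0.
Proof.
move=> XF d1X d2X d3X d11 d22 d33 xU cov Hs; have [c1F c2F c3F] := pyramid_far H.
have [_ _ _ e1 e2 e3 _ _ _ _ _ _ _ _ _ _ _ _ _ _ _] := H.
have H2 := pyramid_rot H; have H3 := pyramid_swap (pyramid_rot H2).
have d1F := subsetP XF _ d1X.
have d2F := subsetP XF _ d2X; have d3F := subsetP XF _ d3X.
have [d12 d13] := far_legs H d1F d11.
have [d23 d21] := far_legs H2 d2F d22; have [d32 d31] := far_legs H3 d3F d33.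
apply/setP=> i; rewrite in_set0; apply/negP=> iB.
have [s1 [s1N s1d s1i]] := blockedE iB d1X.
have [s2 [s2N s2d s2i]] := blockedE iB d2X.
have [s3 [s3N s3d s3i]] := blockedE iB d3X.
have n12 := neighbour_neq s1d d12; have n13 := neighbour_neq s1d d13.
have n21 := neighbour_neq s2d d21; have n23 := neighbour_neq s2d d23.
have n31 := neighbour_neq s3d d31; have n32 := neighbour_neq s3d d32.
move: (xA); rewrite !inE negb_or => /andP[xa2 xa3].
have s12 : s1 != s2 -> s1 = a1 /\ s2 = x.
  move=> s12; have [_ /(_ _ _ s1N s2N _ s12)] := phiP; rewrite s1i s2i => /(_ erefl).
  rewrite !inE (negbTE n12) (negbTE n13) (negbTE n21) /= => /andP[+ /eqP e].
  by move: s12; rewrite e => /negbTE-> /[!orbF] /eqP.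
have s13 : s1 != s3 -> s1 = a1 /\ s3 = x.
  move=> s13; have [_ /(_ _ _ s1N s3N _ s13)] := phiP; rewrite s1i s3i => /(_ erefl).
  rewrite !inE (negbTE n12) (negbTE n13) (negbTE n31) /= => /andP[+ /eqP e].
  by move: s13; rewrite e => /negbTE-> /[!orbF] /eqP.
have [s23|s23] := eqVneq s2 s3; last first.
  case: (altP (s1 =P s2)) => [e|/s12[e1' e2']].
    by move: s23; rewrite -e => /s13[e' _]; rewrite -e e' eqxx in n21.
  have /s13[_ e3'] : s1 != s3 by rewrite e1' eq_sym.
  by rewrite e2' e3' eqxx in s23.
rewrite -s23 in s3d.
have x2 : nb s2 c2 by apply: (cross H2 s2N d2F d3F c2F d22 d33) => //; nbs.
have x3 : nb s2 c3 by apply: (cross H3 s2N d3F d2F c3F d33 d22) => //; nbs.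
case: (altP (s1 =P s2)) => [e|/s12[_ e]]; last by rewrite -e x2 x3 in xU.
rewrite e in s1d; have [d dF] := Hs s2 s2N.
case: (cov d dF) => dd.
- by rewrite (cross H s2N d1F d2F dF).
- by rewrite (cross H2 s2N d2F d3F dF).
- by rewrite (cross H3 s2N d3F d2F dF).
Qed.
End Blocked.

(** By [cross], such a vertex [u] sees the [k - 1] vertices of [far a] other than [c3]; with [a],
    [a1], [a2] and [u] itself this makes [k + 3]. *)
Lemma cross_empty a a1 a2 a3 c1 c2 c3 : pyramid a a1 a2 a3 c1 c2 c3 ->
    #|far a| = k -> {in far a, forall d, [\/ nb d a1, nb d a2 | nb d a3]} ->
    {in far a, forall d, nb d a3 -> d = c3} ->
  {in near a, forall u, nb u c1 -> nb u c2 -> False}.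
Proof.
move=> H Fk cov c3P u uN u1 u2; have [nA n1 n2 _] := pyramid_near H.
have [c1F c2F c3F] := pyramid_far H; have H' := pyramid_swap (pyramid_rot H).
have [_ _ _ e1 e2 e3 _ _ _ ac1 ac2 _ _ _ _ n1c2 _ n2c1 _ _ _] := H.
rewrite nb_sym in e1; rewrite nb_sym in e2.
have ua1 := near_leg Gk uN n1 c1F e1 u1; have ua2 := near_leg Gk uN n2 c2F e2 u2.
have us : uniq [:: a; a1; a2; u].
  have := pyramid_uniq H; rewrite /= !inE !negb_or !andbT.
  case/and3P=> /and3P[-> -> _] /andP[-> _] _ /=.
  rewrite !(eq_sym _ u) (neighbour_neq u1) 1?nb_sym //.
  by rewrite (neighbour_neq u2) 1?nb_sym // (neighbour_neq u1) 1?nb_sym.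
have nX y : y \in near a -> y \notin far a :\ c3.
  by rewrite near_far in_setD1 negb_and => ->; rewrite orbT.
have sX : all (fun y => nb u y && (y \notin far a :\ c3)) [:: a; a1; a2; u].
  rewrite /= !nX // nb_refl ua1 ua2 /= !andbT.
  by rewrite inE in uN.
have uX : {in far a :\ c3, forall y, nb u y}.
  move=> y /setD1P[y3 yF]; case: (cov y yF) => [y1|y2|/(c3P y yF) e].
  - exact: (cross H uN c1F c2F yF e1 e2 y1 u1 u2).
  - exact: (cross H' uN c2F c1F yF e2 e1 y2 u2 u1).
  - by rewrite e eqxx in y3.
have /= := degree_count Gk us sX uX; have := cardsD1 c3 (far a).
by rewrite c3F Fk; clear; lia.
Qed.

(** A deficient [X] omits at most one vertex of [far a]. If it thereby misses a whole leg class,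
    then [#|X| = k - 1] and at most one colour is blocked; otherwise none is blocked and
    [#|X| <= k]. Neither sum exceeds [k]. *)
Lemma pair_coloring_false a a1 a2 a3 c1 c2 c3 x phi : pyramid a a1 a2 a3 c1 c2 c3 ->
  pair_coloring phi a a1 a2 a3 x -> x \notin [:: a2; a3] -> ~~ (nb x c2 && nb x c3) ->
  False.
Proof.
move=> H phiP xA xU; have cl := far_clique Gk k8 H.
have [Fk cov Hs] := far_tight Gk k8 H.
have [X [XF FX Xk]] := deficient Gk k8 cl (proj1 phiP).
have [c1F c2F c3F] := pyramid_far H.
have [_ _ _ e1 e2 e3 _ _ _ _ _ _ _ _ _ _ _ _ _ _ _] := H.
rewrite nb_sym in e1; rewrite nb_sym in e2; rewrite nb_sym in e3.
have [c12 c13 c23] : [/\ c1 != c2, c1 != c3 & c2 != c3].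
  by have := base_uniq H; rewrite /= !inE negb_or andbT => /andP[/andP[]].
have H2 := pyramid_rot H; have Hw := pyramid_swap H.
have covw : {in far a, forall d, [\/ nb d a1, nb d a3 | nb d a2]}.
  by move=> d /cov[?|?|?]; [constructor 1 | constructor 3 | constructor 2].
have cov2 : {in far a, forall d, [\/ nb d a2, nb d a3 | nb d a1]}.
  by move=> d /cov[?|?|?]; [constructor 3 | constructor 1 | constructor 2].
have dich (b c : G) : c \in far a -> nb c b -> (exists2 d, d \in X & nb d b) \/
    X = far a :\ c /\ {in far a, forall d, nb d b -> d = c}.
  move=> cF cb; have [/exists_inP|noX] := boolP [exists d in X, nb d b]; first by left.
  right; have cX : c \notin X.
    by apply: contraNN noX => cX; apply/exists_inP; exists c.
  have Xe : X = far a :\ c.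
    apply/eqP; rewrite eqEcard; apply/andP; split.
      apply/subsetP=> d dX; rewrite in_setD1 (subsetP XF _ dX) andbT.
      by apply: contraNneq cX => <-.
    by move: FX; rewrite (cardsD1 c (far a)) cF.
  split=> // d dF db; apply/eqP; apply: contraNT noX => dc.
  by apply/exists_inP; exists d; rewrite // Xe in_setD1 dc.
have big c v : c \in far a -> X = far a :\ c ->
    (forall i, i \in blocked k phi a X -> v = val i) -> False.
  move=> cF Xe iv; have b1 : #|blocked k phi a X| <= 1.
    by apply/card_le1_eqP=> i j iB jB; apply: val_inj; rewrite -(iv i) // -(iv j).
  move: Xk b1; rewrite Xe; have := cardsD1 c (far a); rewrite cF Fk -Xe.
  by move: #|blocked k phi a X| => b; clear; lia.
have [[d1 d1X d11]|[Xe P1]] := dich a1 c1 c1F e1; last first.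
  have U := cross_empty H2 Fk cov2 P1.
  apply: (big c1 (phi a2)) => // i iB.
  apply: (blocked23 H phiP XF iB (d2 := c2) (d3 := c3)) => //.
    by rewrite Xe in_setD1 c2F eq_sym c12.
  by rewrite Xe in_setD1 c3F eq_sym c13.
have [[d2 d2X d22]|[Xe P2]] := dich a2 c2 c2F e2; last first.
  have U := cross_empty Hw Fk covw P2.
  have phiw : pair_coloring phi a a1 a3 a2 x.
    case: phiP => p1 p2; split=> // s u sN uN su /(p2 s u sN uN su).
    by rewrite !inE ![(_ == a2) || _]orbC.
  apply: (big c2 (phi a1)) => // i iB.
  apply: (blocked12 Hw phiw XF iB (d1 := c1) (d2 := c3)) => //.
    by rewrite Xe in_setD1 c1F c12.
  by rewrite Xe in_setD1 c3F eq_sym c23.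
have [[d3 d3X d33]|[Xe P3]] := dich a3 c3 c3F e3; last first.
  have U := cross_empty H Fk cov P3.
  apply: (big c3 (phi a1)) => // i iB.
  apply: (blocked12 H phiP XF iB (d1 := c1) (d2 := c2)) => //.
    by rewrite Xe in_setD1 c1F c13.
  by rewrite Xe in_setD1 c2F c23.
have B0 := blocked123 H phiP xA XF d1X d2X d3X d11 d22 d33 xU cov Hs.
have := subset_leq_card XF; rewrite Fk; move: Xk; rewrite B0 cards0.
by clear; lia.
Qed.

Definition common_near a c c' := [set s in near a | nb s c && nb s c'].

(** A vertex in both sets would be complete to [far a]. Of the [k + 2] places in the closed
    neighbourhood of [c1], [far a] takes [k] and [a1] one. *)
Lemma common_near_bound a a1 a2 a3 c1 c2 c3 : pyramid a a1 a2 a3 c1 c2 c3 ->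
  #|common_near a c1 c2| + #|common_near a c1 c3| <= 1.
Proof.
move=> H; have cl := far_clique Gk k8 H; have [Fk cov Hs] := far_tight Gk k8 H.
have [c1F c2F c3F] := pyramid_far H; have [nA n1 n2 n3] := pyramid_near H.
have [_ _ _ e1 e2 e3 _ _ _ _ _ _ _ _ _ n12 n13 _ _ _ _] := H.
have H2 := pyramid_rot H; have H3 := pyramid_rot H2.
have dis : [disjoint common_near a c1 c2 & common_near a c1 c3].
  rewrite disjoint_subset; apply/subsetP=> s; rewrite inE => /and3P[sN s1 s2].
  rewrite !inE; apply/negP=> /and3P[_ _ s3]; have [d dF sd] := Hs s sN.
  have [c11 c22 c33] : [/\ nb c1 a1, nb c2 a2 & nb c3 a3] by split; nbs.
  suff : nb s d by rewrite sd.
  case: (cov d dF) => dd.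
  - exact: (cross H sN c1F c2F dF c11 c22).
  - exact: (cross H2 sN c2F c3F dF c22 c33).
  - exact: (cross H3 sN c3F c1F dF c33 c11).
have := far_degree Gk cl c1F; rewrite Fk => deg.
have : #|a1 |: (common_near a c1 c2 :|: common_near a c1 c3)| <=
    #|[set s in near a | nb s c1]|.
  apply/subset_leq_card/subsetP=> s; rewrite in_setU1 in_setU.
  case/predU1P=> [->|]; first by rewrite inE n1.
  by case/orP; rewrite !inE => /and3P[-> ->].
rewrite cardsU1 cardsU disjoint_setI0 // cards0 subn0.
have -> : a1 \notin common_near a c1 c2 :|: common_near a c1 c3.
  by rewrite in_setU ![a1 \in common_near _ _ _]inE n12 n13 !andbF.
by move: deg; clear; lia.
Qed.

(* Otherwise some nonneighbour [x] of [a1] can share the colour of [a1], while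
   [a2] and [a3] share another one. *)
Lemma leg_bound a a1 a2 a3 c1 c2 c3 : pyramid a a1 a2 a3 c1 c2 c3 ->
  #|[set d in far a | nb d a1]| <= 2 + #|common_near a c2 c3|.
Proof.
move=> H; have [nA n1 n2 n3] := pyramid_near H.
have [_ _ _ e1 e2 e3 _ _ _ _ _ _ n12 n23 n31 n1c2 n1c3 _ _ _ _] := H.
have := pyramid_uniq H; rewrite /= !inE !negb_or.
case/and4P=> /and3P[aa1 aa2 aa3] /andP[a12 a13] a23 _.
have phiF x : x \notin [:: a2; a3] -> adj x a1 = false -> ~~ (nb x c2 && nb x c3) ->
    k < #|[set s in near a | (s != a3) && ((s == a1) || (s != x))]|.
  move=> xA xa1 xU; rewrite ltnNge; apply/negP=> Bk.
  have [phi phiP] := pair_coloring_exists H xA xa1 Bk.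
  exact: pair_coloring_false H phiP xA xU.
(* With [x := a1] only the pair [a2], [a3] is formed; that this does not suffice forces [near a] to
   have [k + 2] vertices. *)
have nk : k < #|near a :\ a3|.
  have := phiF a1; rewrite !inE negb_or a12 a13 adj_irrefl n1c2 => /(_ isT erefl isT) lt.
  apply: leq_trans lt _; apply/subset_leq_card/subsetP=> s.
  by rewrite inE in_setD1 => /and3P[-> ->].
(* A vertex outside both sets could share the colour of [a1], and the two pairs would save two
   colours. *)
have Rin x : x \in near a :\ a3 :\ a2 -> (nb a1 x) || (x \in common_near a c2 c3).
  rewrite 2!in_setD1 => /and3P[x2 x3 xN].
  rewrite inE xN /=; apply: contraT; rewrite negb_or => /andP[/negbTE x1 xU].
  have xA : x \notin [:: a2; a3] by rewrite !inE negb_or x2.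
  have /nb_false_adj xa1 : nb x a1 = false by rewrite nb_sym.
  have := phiF x xA xa1 xU; have := near_degree Gk a.
  rewrite (cardsD1 a3) n3 (cardsD1 x) in_setD1 x3 xN => le lt.
  have : #|[set s in near a | (s != a3) && ((s == a1) || (s != x))]| <= #|near a :\ a3 :\ x|.
    apply/subset_leq_card/subsetP=> s; rewrite inE 2!in_setD1.
    case/and3P=> -> -> /orP[/eqP->|->//]; rewrite !andbT.
    by apply: contraFneq x1 => ->; apply: nb_refl.
  by move: le lt; clear; lia.
(* The first set has at least [k - #|common_near a c2 c3|] vertices, so the closed neighbourhood of
   [a1] has room for [2 + #|common_near a c2 c3|] in the second. *)
have sub : (near a :\ a3 :\ a2) :\: common_near a c2 c3 :|: [set d in far a | nb d a1]
    \subset [set y | nb a1 y].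
  apply/subsetP=> y; rewrite in_setU in_setD [y \in [set _ | nb a1 _]]inE.
  case/orP=> [/andP[/negbTE yU /Rin]|]; first by rewrite yU orbF.
  by rewrite inE nb_sym => /andP[].
have := leq_trans (subset_leq_card sub) (critical_degree Gk a1).
rewrite cardsU disjoint_setI0; last first.
  rewrite disjoint_subset; apply/subsetP=> y; rewrite in_setD 2!in_setD1.
  case/and4P=> _ _ _ yN; rewrite inE; apply/negP; rewrite inE => /andP[yF _].
  by rewrite near_far yF in yN.
have := cardsD (near a :\ a3 :\ a2) (common_near a c2 c3).
have := subset_leq_card (subsetIr (near a :\ a3 :\ a2) (common_near a c2 c3)).
have := cardsD1 a2 (near a :\ a3); rewrite in_setD1 a23 n2 cards0 subn0.
by move: nk; clear; lia.
Qed.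

(** The three bounds on common neighbours count each set twice, so the sets have at most one vertex
    in total. Adding the three leg bounds gives [k <= 3 * 2 + 1]. *)
Theorem no_pyramid a a1 a2 a3 c1 c2 c3 : pyramid a a1 a2 a3 c1 c2 c3 -> False.
Proof.
move=> H; have H2 := pyramid_rot H; have H3 := pyramid_rot H2.
have [Fk cov _] := far_tight Gk k8 H.
have := leg_bound H; have := leg_bound H2; have := leg_bound H3.
have := common_near_bound H; have := common_near_bound H2; have := common_near_bound H3.
have comC c c' : common_near a c c' = common_near a c' c.
  by apply/setP=> s; rewrite !inE andbA andbAC -andbA.
rewrite (comC c3 c2) (comC c3 c1) (comC c2 c1).
pose C b := [set d in far a | nb d b].
have : #|far a| <= #|C a1 :|: C a2 :|: C a3|.
  apply/subset_leq_card/subsetP=> d dF; rewrite !in_setU ![d \in C _]inE dF.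
  by case: (cov d dF) => ->; rewrite ?orbT.
rewrite Fk -/(C a1) -/(C a2) -/(C a3).
have := leq_of_leqif (leq_card_setU (C a1 :|: C a2) (C a3)).
have := leq_of_leqif (leq_card_setU (C a1) (C a2)).
by move: k8; clear; lia.
Qed.

End PairColoring.

(** * Pyramid-free critical graphs *)

Section Enlarge.
Variables (k : nat) (G : sgraph).
Hypotheses (Gk : critical k G) (k8 : 8 <= k).
Implicit Types (x y z t : G) (P : {set G}).

Let h4 := critical_noC4 Gk.
Let h6 := critical_noC6 Gk.

(** The vertices with the same trace as [w2] on the five-cycle, [w2] included; so the class of [v1]
    is [blow v5 v1 v2 v3 v4]. *)
Definition blow w1 w2 w3 w4 w5 := [set x : G |
  [&& nb x w1, nb x w2, nb x w3, ~~ nb x w4 & ~~ nb x w5]].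

Definition ring v1 v2 v3 v4 v5 :=
  blow v5 v1 v2 v3 v4 :|: blow v1 v2 v3 v4 v5 :|: blow v2 v3 v4 v5 v1 :|:
  blow v3 v4 v5 v1 v2 :|: blow v4 v5 v1 v2 v3.

Lemma ring_rot v1 v2 v3 v4 v5 : ring v2 v3 v4 v5 v1 = ring v1 v2 v3 v4 v5.
Proof.
apply/setP=> x; rewrite !inE.
by case: (nb x v1) (nb x v2) (nb x v3) (nb x v4) (nb x v5) => [] [] [] [] [].
Qed.

Lemma ring_rev v1 v2 v3 v4 v5 : ring v1 v5 v4 v3 v2 = ring v1 v2 v3 v4 v5.
Proof.
apply/setP=> x; rewrite !inE.
by case: (nb x v1) (nb x v2) (nb x v3) (nb x v4) (nb x v5) => [] [] [] [] [].
Qed.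

Lemma blow_rev w1 w2 w3 w4 w5 : blow w3 w2 w1 w5 w4 = blow w1 w2 w3 w4 w5.
Proof.
apply/setP=> x; rewrite !inE.
by case: (nb x w1) (nb x w2) (nb x w3) (nb x w4) (nb x w5) => [] [] [] [] [].
Qed.

Lemma in_ring v1 v2 v3 v4 v5 x : x \in ring v1 v2 v3 v4 v5 ->
  [\/ x \in blow v5 v1 v2 v3 v4, x \in blow v1 v2 v3 v4 v5
   | x \in blow v2 v3 v4 v5 v1] \/
  x \in blow v3 v4 v5 v1 v2 \/ x \in blow v4 v5 v1 v2 v3.
Proof.
rewrite !in_setU -!orbA.
by case/or4P=> [->|->|->|/orP[]->];
  [left; constructor 1|left; constructor 2|left; constructor 3|right; left|right; right].
Qed.

Lemma blow_ring v1 v2 v3 v4 v5 x :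
  [|| x \in blow v5 v1 v2 v3 v4, x \in blow v1 v2 v3 v4 v5,
   x \in blow v2 v3 v4 v5 v1, x \in blow v3 v4 v5 v1 v2 | x \in blow v4 v5 v1 v2 v3] ->
  x \in ring v1 v2 v3 v4 v5.
Proof. by rewrite !in_setU -!orbA. Qed.

Lemma ring_proper v1 v2 v3 v4 v5 w1 w2 w3 w4 w5 y :
  ring v1 v2 v3 v4 v5 \subset ring w1 w2 w3 w4 w5 ->
  y \in ring w1 w2 w3 w4 w5 -> y \notin ring v1 v2 v3 v4 v5 ->
  #|ring v1 v2 v3 v4 v5| < #|ring w1 w2 w3 w4 w5|.
Proof.
by move=> sub yW yV; apply: proper_card; rewrite properE sub; apply/subsetPn; exists y.
Qed.

Lemma blow_anti v1 v2 v3 v4 v5 x y : C5 v1 v2 v3 v4 v5 ->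
  x \in blow v5 v1 v2 v3 v4 -> y \in blow v2 v3 v4 v5 v1 -> nb x y = false.
Proof.
case=> ? ? ? ? ? ? ? ? ? ?; rewrite !inE.
move=> /and5P[? ? ? /negbTE? /negbTE?] /and5P[? ? ? /negbTE? /negbTE?].
apply/negP=> ?.
by apply: (h4 (a := x) (b := y) (c := v4) (d := v5)); nbs.
Qed.

Lemma blow_clique v1 v2 v3 v4 v5 : C5 v1 v2 v3 v4 v5 ->
  nb_clique (blow v5 v1 v2 v3 v4).
Proof.
move=> C x y; rewrite !inE => /and5P[? ? ? _ _] /and5P[? ? ? _ _].
exact: (C5_common Gk (C5_rot (C5_rot (C5_rot (C5_rot C))))).
Qed.

(** Replacing [v1] by [b] gives a five-cycle, which must dominate [t]. *)
Lemma pendant_complete v1 v2 v3 v4 v5 t b : C5 v1 v2 v3 v4 v5 ->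
  pat v1 v2 v3 v4 v5 t true false false false false ->
  b \in blow v5 v1 v2 v3 v4 -> nb t b.
Proof.
case=> ? ? ? ? ? ? ? ? ? ? [t1 t2 t3 t4 t5].
rewrite inE => /and5P[? ? ? /negbTE? /negbTE?].
have C' : C5 b v2 v3 v4 v5 by split; nbs.
by have := C5_dom Gk t C'; rewrite t2 t3 t4 t5 !orbF.
Qed.

Lemma enlarge_T_half v1 v2 v3 v4 v5 y b2 b5 b : C5 v1 v2 v3 v4 v5 ->
  pat v1 v2 v3 v4 v5 y true false false false false ->
  b2 \in blow v1 v2 v3 v4 v5 -> b5 \in blow v4 v5 v1 v2 v3 ->
  nb y b2 -> nb y b5 ->
  b \in blow v5 v1 v2 v3 v4 \/ b \in blow v2 v3 v4 v5 v1 -> nb b b2.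
Proof.
move=> C py b2B b5B yb2 yb5 bB; apply: contraT => /negbTE bb2; exfalso.
case: bB => bB; have := bB; have := b2B; have := b5B; rewrite !inE.
  have yb := pendant_complete C py bB; case: C py => ? ? ? ? ? ? ? ? ? ? [? ? ? ? ?].
  move=> /and5P[? ? ? /negbTE? /negbTE?] /and5P[? ? ? /negbTE? /negbTE?].
  move=> /and5P[? ? ? /negbTE? /negbTE?].
  by apply: (h4 (a := y) (b := b) (c := v2) (d := b2)); nbs.
have b25 := blow_anti (C5_rot (C5_rot (C5_rot (C5_rot C)))) b5B b2B.
have b35 := blow_anti (C5_rot (C5_rot C)) bB b5B.
case: C py => ? ? ? ? ? ? ? ? ? ? [? ? ? ? ?].
move=> /and5P[? ? ? /negbTE? /negbTE?] /and5P[? ? ? /negbTE? /negbTE?].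
move=> /and5P[? ? ? /negbTE? /negbTE?].
have yb : nb y b = false.
  apply/negP=> ?.
  by apply: (h4 (a := y) (b := b) (c := v2) (d := v1)); nbs.
by apply: (h6 (a := y) (b := b2) (c := v2) (d := b) (e := v4) (f := b5)); nbs.
Qed.

(** Exchanging [v2] and [v5] for neighbours of [y] in their classes brings [y] into the ring, and
    every old member keeps its class. *)
Lemma enlarge_T v1 v2 v3 v4 v5 y b2 b5 : C5 v1 v2 v3 v4 v5 ->
  pat v1 v2 v3 v4 v5 y true false false false false ->
  b2 \in blow v1 v2 v3 v4 v5 -> b5 \in blow v4 v5 v1 v2 v3 ->
  nb y b2 -> nb y b5 ->
  C5 v1 b2 v3 v4 b5 /\ #|ring v1 v2 v3 v4 v5| < #|ring v1 b2 v3 v4 b5|.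
Proof.
move=> C py b2B b5B yb2 yb5.
have b5B' : b5 \in blow v1 v5 v4 v3 v2 by rewrite blow_rev.
have b2B' : b2 \in blow v3 v2 v1 v5 v4 by rewrite blow_rev.
have b52 := blow_anti (C5_rot (C5_rot (C5_rot (C5_rot C)))) b5B b2B.
have C4 := C5_rot (C5_rot (C5_rot (C5_rot C))).
have h1 b : b \in blow v5 v1 v2 v3 v4 -> nb b b2 /\ nb b b5.
  move=> bB; split; first by apply: (enlarge_T_half C py b2B b5B) => //; left.
  apply: (enlarge_T_half (C5_rev C) (pat_rev py) b5B' b2B') => //; left.
  by rewrite blow_rev.
have h3 b : b \in blow v2 v3 v4 v5 v1 -> nb b b2 /\ nb b b5 = false.
  move=> bB; split; first by apply: (enlarge_T_half C py b2B b5B) => //; right.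
  exact: (blow_anti (C5_rot (C5_rot C)) bB b5B).
have h4' b : b \in blow v3 v4 v5 v1 v2 -> nb b b5 /\ nb b b2 = false.
  move=> bB; split.
    apply: (enlarge_T_half (C5_rev C) (pat_rev py) b5B' b2B') => //; right.
    by rewrite blow_rev.
  by rewrite nb_sym; apply: (blow_anti (C5_rot C) b2B bB).
have h2 b : b \in blow v1 v2 v3 v4 v5 -> nb b b2 /\ nb b b5 = false.
  move=> bB; split; first exact: (blow_clique (C5_rot C) bB b2B).
  by rewrite nb_sym; apply: (blow_anti C4 b5B bB).
have h5 b : b \in blow v4 v5 v1 v2 v3 -> nb b b5 /\ nb b b2 = false.
  move=> bB; split; first exact: (blow_clique C4 bB b5B).
  exact: (blow_anti C4 bB b2B).
case: C py => ? ? ? ? ? ? ? ? ? ? [y1 y2 y3 y4 y5].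
move: (b2B) (b5B); rewrite !inE.
move=> /and5P[? ? ? /negbTE? /negbTE?] /and5P[? ? ? /negbTE? /negbTE?].
split; first by split; nbs.
apply: (@ring_proper _ _ _ _ _ _ _ _ _ _ y).
- apply/subsetP=> x /in_ring[[xB|xB|xB]|[xB|xB]]; apply: blow_ring;
    rewrite !inE; move: (xB); rewrite !inE => /and5P[e1 e2 e3 e4 e5].
  + by have [-> ->] := h1 x xB; rewrite e2 e4 e5.
  + by have [-> ->] := h2 x xB; rewrite e1 e3 e4 ?orbT.
  + by have [-> ->] := h3 x xB; rewrite e2 e3 e5 ?orbT.
  + by have [-> ->] := h4' x xB; rewrite e1 e2 e4 ?orbT.
  + by have [-> ->] := h5 x xB; rewrite e1 e3 e5 ?orbT.
- by apply: blow_ring; rewrite !inE y1 y3 y4 yb2 yb5.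
- by rewrite !inE y1 y2 y3 y4 y5.
Qed.

(** Here [v3] is exchanged for [b3]. Keeping the class of [v2] complete to [b3] is the step of this
    exchange that needs the absence of pyramids. *)
Lemma enlarge_E v1 v2 v3 v4 v5 y b3 : C5 v1 v2 v3 v4 v5 ->
  pat v1 v2 v3 v4 v5 y true true false false false ->
  b3 \in blow v2 v3 v4 v5 v1 -> nb y b3 ->
  C5 v1 v2 b3 v4 v5 /\ #|ring v1 v2 v3 v4 v5| < #|ring v1 v2 b3 v4 v5|.
Proof.
move=> C py b3B yb3; have C2 := C5_rot C; have C3 := C5_rot C2; have C4 := C5_rot C3.
have h1 b : b \in blow v5 v1 v2 v3 v4 -> nb b b3 = false.
  by move=> bB; apply: (blow_anti C bB b3B).
have h5 b : b \in blow v4 v5 v1 v2 v3 -> nb b b3 = false.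
  by move=> bB; rewrite nb_sym; apply: (blow_anti C3 b3B bB).
have h3 b : b \in blow v2 v3 v4 v5 v1 -> nb b b3.
  by move=> bB; apply: (blow_clique C3 bB b3B).
have [d1 d2 d3 d4 d5 d6 d7 d8 d9 d10] := C; have [y1 y2 y3 y4 y5] := py.
move: (b3B); rewrite !inE => /and5P[f1 f2 f3 /negbTE f4 /negbTE f5].
have h2 b : b \in blow v1 v2 v3 v4 v5 -> nb b b3.
  rewrite !inE => /and5P[? ? ? /negbTE? /negbTE?]; apply: contraT => /negbTE bb; exfalso.
  have yb : nb y b = false.
    by apply/negP=> ?; apply: (h4 (a := y) (b := b) (c := v3) (d := b3)); nbs.
  apply: (no_pyramid Gk k8 (a := v1) (a1 := b) (a2 := y) (a3 := v5)
    (c1 := v3) (c2 := b3) (c3 := v4)).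
  by split; nbs.
have h4' b : b \in blow v3 v4 v5 v1 v2 -> nb b b3.
  rewrite !inE => /and5P[? ? ? /negbTE? /negbTE?]; apply: contraT => /negbTE bb; exfalso.
  have yb : nb y b = false.
    by apply/negP=> ?; apply: (h4 (a := y) (b := b) (c := v3) (d := v2)); nbs.
  by apply: (h6 (a := y) (b := b3) (c := v3) (d := b) (e := v5) (f := v1)); nbs.
split; first by split; nbs.
apply: (@ring_proper _ _ _ _ _ _ _ _ _ _ y).
- apply/subsetP=> x /in_ring[[xB|xB|xB]|[xB|xB]]; apply: blow_ring;
    rewrite !inE; move: (xB); rewrite !inE => /and5P[e1 e2 e3 e4 e5].
  + by rewrite (h1 x xB) e1 e2 e3 e5.
  + by rewrite (h2 x xB) e1 e2 e4 e5 ?orbT.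
  + by rewrite (h3 x xB) e1 e3 e4 e5 ?orbT.
  + by rewrite (h4' x xB) e2 e3 e4 e5 ?orbT.
  + by rewrite (h5 x xB) e1 e2 e3 e4 ?orbT.
- by apply: blow_ring; rewrite !inE y1 y2 y4 y5 yb3 ?orbT.
- by rewrite !inE y1 y2 y3 y4 y5.
Qed.

End Enlarge.

(** * Five-cycles with the largest ring *)

Section MaximalRing.
Variables (k : nat) (G : sgraph).
Hypotheses (Gk : critical k G) (k8 : 8 <= k).
Implicit Types (x y z t p q : G) (P : {set G}).

Let h4 := critical_noC4 Gk.
Let h6 := critical_noC6 Gk.
Let hP := critical_noP6 Gk.

Record max_C5 (v1 v2 v3 v4 v5 : G) : Prop := MaxC5 {
  max_C5_C5 : C5 v1 v2 v3 v4 v5;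
  max_C5_ring : forall w1 w2 w3 w4 w5 : G, C5 w1 w2 w3 w4 w5 ->
    #|ring w1 w2 w3 w4 w5| <= #|ring v1 v2 v3 v4 v5| }.

Lemma max_C5_exists : exists v1 v2 v3 v4 v5 : G, max_C5 v1 v2 v3 v4 v5.
Proof.
pose c5b (v : G * G * G * G * G) := let: (v1, v2, v3, v4, v5) := v in
  [&& nb v1 v2, nb v2 v3, nb v3 v4, nb v4 v5 & nb v5 v1] &&
  [&& ~~ nb v1 v3, ~~ nb v2 v4, ~~ nb v3 v5, ~~ nb v4 v1 & ~~ nb v5 v2].
have c5P v1 v2 v3 v4 v5 : reflect (C5 v1 v2 v3 v4 v5) (c5b (v1, v2, v3, v4, v5)).
  apply: (iffP andP) => [[/and5P[? ? ? ? ?]]|[? ? ? ? ? -> -> -> -> ->]].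
    by case/and5P=> /negbTE? /negbTE? /negbTE? /negbTE? /negbTE?; split.
  by split=> //; apply/and5P.
have [w1 [w2 [w3 [w4 [w5 /c5P W]]]]] := C5_exists Gk.
pose F (v : G * G * G * G * G) := let: (v1, v2, v3, v4, v5) := v in #|ring v1 v2 v3 v4 v5|.
case: (@arg_maxnP _ _ c5b F W) => -[[[[v1 v2] v3] v4] v5] /c5P V M.
exists v1, v2, v3, v4, v5; split=> // u1 u2 u3 u4 u5 /c5P /M.
exact.
Qed.

Lemma max_C5_rot v1 v2 v3 v4 v5 : max_C5 v1 v2 v3 v4 v5 -> max_C5 v2 v3 v4 v5 v1.
Proof.
case=> C M; split=> [|w1 w2 w3 w4 w5 /M]; first exact: C5_rot C.
by rewrite (ring_rot v1 v2 v3 v4 v5).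
Qed.

Lemma max_C5_rev v1 v2 v3 v4 v5 : max_C5 v1 v2 v3 v4 v5 -> max_C5 v1 v5 v4 v3 v2.
Proof.
case=> C M; split=> [|w1 w2 w3 w4 w5 /M]; first exact: C5_rev C.
by rewrite (ring_rev v1 v2 v3 v4 v5).
Qed.

Lemma max_C5_T v1 v2 v3 v4 v5 y b2 b5 : max_C5 v1 v2 v3 v4 v5 ->
  pat v1 v2 v3 v4 v5 y true false false false false ->
  b2 \in blow v1 v2 v3 v4 v5 -> b5 \in blow v4 v5 v1 v2 v3 ->
  nb y b2 -> nb y b5 -> False.
Proof.
case=> C M py b2B b5B y2 y5.
have [W lt] := enlarge_T Gk C py b2B b5B y2 y5.
by have := M _ _ _ _ _ W; rewrite leqNgt lt.
Qed.

Lemma max_C5_E v1 v2 v3 v4 v5 y b3 : max_C5 v1 v2 v3 v4 v5 ->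
  pat v1 v2 v3 v4 v5 y true true false false false ->
  b3 \in blow v2 v3 v4 v5 v1 -> nb y b3 -> False.
Proof.
case=> C M py b3B y3; have [W lt] := enlarge_E Gk k8 C py b3B y3.
by have := M _ _ _ _ _ W; rewrite leqNgt lt.
Qed.

Definition cap v3 v4 v5 := [set y : G | [&& ~~ nb y v3, ~~ nb y v4 & ~~ nb y v5]].

(* The vertices attached to the edge [v1 v2] only are separated from [v4] by
   their neighbours in the ring and the vertices complete to the five-cycle. *)
Record capped (v1 v2 v3 v4 v5 : G) : Prop := Capped {
  capped_max : max_C5 v1 v2 v3 v4 v5;
  capped_23 : forall x, ~ pat v1 v2 v3 v4 v5 x false true true false false;
  capped_51 : forall x, ~ pat v1 v2 v3 v4 v5 x true false false false true }.

Lemma capped_rev v1 v2 v3 v4 v5 : capped v1 v2 v3 v4 v5 -> capped v2 v1 v5 v4 v3.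
Proof.
case=> M n23 n51; split.
- exact: max_C5_rev (max_C5_rot M).
- by move=> x [x1 x2 x3 x4 x5]; apply: (n51 x); split.
- by move=> x [x1 x2 x3 x4 x5]; apply: (n23 x); split.
Qed.

Lemma cap_anti v3 v4 v5 : [/\ anti (cap v3 v4 v5) v3, anti (cap v3 v4 v5) v4 &
  anti (cap v3 v4 v5) v5].
Proof. by split=> y; rewrite inE => /and3P[/negbTE? /negbTE? /negbTE?]. Qed.

Lemma cap_rev v3 v4 v5 : cap v5 v4 v3 = cap v3 v4 v5.
Proof.
by apply/setP=> y; rewrite !inE; case: (nb y v3) (nb y v4) (nb y v5) => [] [] [].
Qed.

Section Cap.
Variables v1 v2 v3 v4 v5 : G.
Hypothesis V : capped v1 v2 v3 v4 v5.

Let C : C5 v1 v2 v3 v4 v5 := max_C5_C5 (capped_max V).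

Lemma cap_T_C4 y p : p \in cap v3 v4 v5 -> nb y p ->
  (nb p v1 ==> (nb y v5 ==> nb y v1)) && (nb p v2 ==> (nb y v3 ==> nb y v2)).
Proof.
rewrite inE => /and3P[/negbTE? /negbTE? /negbTE?] ?; case: C => *.
apply/andP; split; apply/implyP=> ?; apply/implyP=> ?; apply: contraT => /negbTE ?;
  exfalso.
  by apply: (h4 (a := y) (b := p) (c := v1) (d := v5)); nbs.
by apply: (h4 (a := y) (b := p) (c := v2) (d := v3)); nbs.
Qed.

(** The class of [v4] is absent because its vertices would close a four-cycle with [p] along [v1 v5]
    or [v2 v3]. Traces of one or two vertices are excluded by [capped], by four-cycles, by conflicts
    with [p] or, opposite to the trace of [p], by the pyramid they would create. *)
Lemma cap_boundary y p : p \in cap v3 v4 v5 -> nb y p -> y \notin cap v3 v4 v5 ->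
  [\/ y \in blow v5 v1 v2 v3 v4, y \in blow v1 v2 v3 v4 v5,
      y \in blow v2 v3 v4 v5 v1 | y \in blow v4 v5 v1 v2 v3] \/
  pat v1 v2 v3 v4 v5 y true true true true true.
Proof.
move=> pP yp yP; have := pP; have := cap_T_C4 pP yp; have := yP; rewrite !inE.
have p12 := C5_dom Gk p C.
have a1 := C5_arc Gk y C; have a2 := C5_arc Gk y (C5_rot C).
have a3 := C5_arc Gk y (C5_rot (C5_rot C)).
have a4 := C5_arc Gk y (C5_rot (C5_rot (C5_rot C))).
have a5 := C5_arc Gk y (C5_rot (C5_rot (C5_rot (C5_rot C)))).
have n23 : ~~ [&& ~~ nb y v1, nb y v2, nb y v3, ~~ nb y v4 & ~~ nb y v5].
  by apply/negP=> /and5P[/negbTE? ? ? /negbTE? /negbTE?]; apply: (capped_23 V (x := y)).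
have n51 : ~~ [&& nb y v1, ~~ nb y v2, ~~ nb y v3, ~~ nb y v4 & nb y v5].
  by apply/negP=> /and5P[? /negbTE? /negbTE? /negbTE? ?]; apply: (capped_51 V (x := y)).
move=> yP' f12 /and3P[/negbTE p3 /negbTE p4 /negbTE p5].
rewrite p3 p4 p5 !orbF in p12.
have [d1 d2 d3 d4 d5 d6 d7 d8 d9 d10] := C.
suff : [|| [&& nb y v5, nb y v1, nb y v2, ~~ nb y v3 & ~~ nb y v4],
  [&& nb y v1, nb y v2, nb y v3, ~~ nb y v4 & ~~ nb y v5],
  [&& nb y v2, nb y v3, nb y v4, ~~ nb y v5 & ~~ nb y v1],
  [&& nb y v4, nb y v5, nb y v1, ~~ nb y v2 & ~~ nb y v3] |
  [&& nb y v1, nb y v2, nb y v3, nb y v4 & nb y v5]].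
  case/or4P=> [->|->|->|/orP[->|/and5P[]]]; [left; constructor 1|
    left; constructor 2|left; constructor 3|left; constructor 4|right; split] => //.
case p1: (nb p v1) p12 f12; case p2: (nb p v2) => //= _.
- have t4 : ~~ [&& ~~ nb y v1, ~~ nb y v2, ~~ nb y v3, nb y v4 & ~~ nb y v5].
    apply/negP=> /and5P[/negbTE? /negbTE? /negbTE? ? /negbTE?].
    apply: (no_pyramid Gk k8 (a := v4) (a1 := v3) (a2 := v5) (a3 := y)
      (c1 := v2) (c2 := v1) (c3 := p)).
    by split; nbs.
  move: a1 a2 a3 a4 a5 n23 n51 yP' t4.
  by case: (nb y v1) (nb y v2) (nb y v3) (nb y v4) (nb y v5) => [] [] [] [] [].
- have pp : pat v1 v2 v3 v4 v5 p true false false false false by split.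
  have := conflict_TT Gk y C pp; have := conflict_TT Gk y (C5_rev C) (pat_rev pp).
  have e3 : ~~ [&& ~~ nb y v1, ~~ nb y v2, nb y v3, nb y v4 & ~~ nb y v5].
    apply/negP=> /and5P[/negbTE? /negbTE? ? ? /negbTE?].
    apply: (no_pyramid Gk k8 (a := v1) (a1 := v2) (a2 := v5) (a3 := p)
      (c1 := v3) (c2 := v4) (c3 := y)).
    by split; nbs.
  move: a1 a2 a3 a4 a5 n23 n51 yP' e3.
  by case: (nb y v1) (nb y v2) (nb y v3) (nb y v4) (nb y v5) => [] [] [] [] [].
- have pp : pat v2 v3 v4 v5 v1 p true false false false false by split.
  have := conflict_TT Gk y (C5_rot C) pp.
  have := conflict_TT Gk y (C5_rev (C5_rot C)) (pat_rev pp).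
  have e4 : ~~ [&& ~~ nb y v1, ~~ nb y v2, ~~ nb y v3, nb y v4 & nb y v5].
    apply/negP=> /and5P[/negbTE? /negbTE? /negbTE? ? ?].
    apply: (no_pyramid Gk k8 (a := v2) (a1 := v3) (a2 := v1) (a3 := p)
      (c1 := v4) (c2 := v5) (c3 := y)).
    by split; nbs.
  move: a1 a2 a3 a4 a5 n23 n51 yP' e4.
  by case: (nb y v1) (nb y v2) (nb y v3) (nb y v4) (nb y v5) => [] [] [] [] [].
Qed.

(** If [p] sees both [v1] and [v2], exchanging [v3] for [y] enlarges the ring; if it sees only [v1],
    then [y p v1 v2] is a four-cycle. *)
Lemma cap_blow3 y p : p \in cap v3 v4 v5 -> nb y p -> y \in blow v2 v3 v4 v5 v1 ->
  nb p v1 = false /\ nb p v2.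
Proof.
move=> pP yp yB; have := pP; rewrite inE => /and3P[/negbTE p3 /negbTE p4 /negbTE p5].
have := yB; rewrite inE => /and5P[? ? ? /negbTE? /negbTE?]; case: (C) => *.
have := C5_dom Gk p C; rewrite p3 p4 p5 !orbF.
case p1: (nb p v1) => /=; last by [].
case p2: (nb p v2) => _; exfalso.
  have pp : pat v1 v2 v3 v4 v5 p true true false false false by split.
  by apply: (max_C5_E (capped_max V) pp yB); rewrite nb_sym.
by apply: (h4 (a := y) (b := p) (c := v1) (d := v2)); nbs.
Qed.

End Cap.

Section CapPairs.
Variables v1 v2 v3 v4 v5 y z : G.
Hypotheses (V : capped v1 v2 v3 v4 v5) (yz : nb y z = false)
  (L : linked (cap v3 v4 v5) y z).

Let C : C5 v1 v2 v3 v4 v5 := max_C5_C5 (capped_max V).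

Lemma cap_blow5 u p : p \in cap v3 v4 v5 -> nb u p -> u \in blow v4 v5 v1 v2 v3 ->
  nb p v2 = false /\ nb p v1.
Proof.
rewrite -cap_rev => pP up uB; apply: (cap_blow3 (capped_rev V) pP up).
by rewrite blow_rev.
Qed.

(** The digits in these names are the classes of [y] and [z]. Here [y v5 v4 v3 z] is an outer
    path. *)
Lemma cap_12 : y \in blow v5 v1 v2 v3 v4 -> z \in blow v1 v2 v3 v4 v5 -> False.
Proof.
rewrite !inE => /and5P[? ? ? /negbTE? /negbTE?] /and5P[? ? ? /negbTE? /negbTE?].
have [? ? ?] := cap_anti v3 v4 v5; case: C => *.
by apply: (out4 h6 hP (w1 := v5) (w2 := v4) (w3 := v3) (P := cap v3 v4 v5)
  (x := y) (y := z)); nbs.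
Qed.

(** The outer path [y v5 v4 z] leaves a common neighbour in the cap, attached to [v2] only;
    exchanging [v1] and [v3] for [y] and [z] would then enlarge the ring. *)
Lemma cap_13 : y \in blow v5 v1 v2 v3 v4 -> z \in blow v2 v3 v4 v5 v1 -> False.
Proof.
move=> yB zB; have [p pP [yp pz]] : exists2 p, p \in cap v3 v4 v5 & nb y p /\ nb p z.
  have [? ? ?] := cap_anti v3 v4 v5; case: C => *; move: yB zB; rewrite !inE.
  move=> /and5P[? ? ? /negbTE? /negbTE?] /and5P[? ? ? /negbTE? /negbTE?].
  by apply: (out3 h6 hP (w1 := v5) (w2 := v4)); nbs.
have zp : nb z p by rewrite nb_sym.
have [p1 p2] := cap_blow3 V pP zp zB.
move: (pP); rewrite inE => /and3P[/negbTE? /negbTE? /negbTE?].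
have pp : pat v2 v3 v4 v5 v1 p true false false false false by split.
by apply: (max_C5_T (max_C5_rot (capped_max V)) pp zB yB); nbs.
Qed.

(** A neighbour [q] of [z] in the cap is attached to [v1] only, hence adjacent to [y], and
    [q y v5 z] is a four-cycle. *)
Lemma cap_15 : y \in blow v5 v1 v2 v3 v4 -> z \in blow v4 v5 v1 v2 v3 -> False.
Proof.
move=> yB zB; have [q qP zq] := linkedS (linked_sym L).
have [q2 q1] := cap_blow5 qP zq zB.
move: (qP); rewrite inE => /and3P[/negbTE? /negbTE? /negbTE?].
have qq : pat v1 v2 v3 v4 v5 q true false false false false by split.
have qy := pendant_complete Gk C qq yB; case: (C) => *; move: yB zB; rewrite !inE.
move=> /and5P[? ? ? /negbTE? /negbTE?] /and5P[? ? ? /negbTE? /negbTE?].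
by apply: (h4 (a := q) (b := y) (c := v5) (d := z)); nbs.
Qed.

(** On the cycle, neighbours of [y] in the cap see only [v2] and those of [z] only [v1]. So one
    inner vertex is impossible, two close a four-cycle with [v2 v1], and three close a [C_6] through
    [v4]. *)
Lemma cap_35 : y \in blow v2 v3 v4 v5 v1 -> z \in blow v4 v5 v1 v2 v3 -> False.
Proof.
move=> yB zB; have [_ P4 _] := cap_anti v3 v4 v5.
have B3 p : p \in cap v3 v4 v5 -> nb y p -> nb p v1 = false /\ nb p v2.
  by move=> pP yp; exact: (cap_blow3 V pP yp yB).
have B5 p : p \in cap v3 v4 v5 -> nb p z -> nb p v2 = false /\ nb p v1.
  by move=> pP zp; apply: (cap_blow5 pP _ zB); rewrite nb_sym.
case: (C) => *; move: yB zB; rewrite !inE.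
move=> /and5P[? ? ? /negbTE? /negbTE?] /and5P[? ? ? /negbTE? /negbTE?].
case: (linkedP hP yz L) => [p pP yp pz|p q pP qP yp pq qz _ _|p q r pP qP rP *].
- by have [p1 _] := B3 p pP yp; have [_] := B5 p pP pz; rewrite p1.
- have [? ?] := B3 p pP yp; have [? ?] := B5 q qP qz.
  by apply: (h4 (a := p) (b := v2) (c := v1) (d := q)); nbs.
- have ? := P4 p pP; have ? := P4 q qP; have ? := P4 r rP.
  by apply: (h6 (a := y) (b := p) (c := q) (d := r) (e := z) (f := v4)); nbs.
Qed.

End CapPairs.

(** Two boundary vertices in the same class, or one of them complete to the cycle, have two common
    nonadjacent neighbours and are adjacent. The remaining pairs of classes are the four above, up
    to exchanging [y] and [z] and reflecting the cycle. *)
Lemma cap_empty v1 v2 v3 v4 v5 : capped v1 v2 v3 v4 v5 -> cap v3 v4 v5 = set0.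
Proof.
move=> V; have C := max_C5_C5 (capped_max V).
apply/eqP; apply: contraT => /set0Pn[x xP]; exfalso.
have [_ P4 _] := cap_anti v3 v4 v5.
have [y [z [yz yP zP L]]] := boundary Gk xP P4.
have zy : nb z y = false by rewrite nb_sym.
have L' := linked_sym L; have V' := capped_rev V.
have [p pP yp] := linkedS L; have [q qP zq] := linkedS L'.
have bL u v : nb u v = false -> linked (cap v3 v4 v5) u v ->
    linked (cap v5 v4 v3) u v by rewrite cap_rev.
have M := bL _ _ yz L; have M' := bL _ _ zy L'.
have C4 := C5_rot (C5_rot (C5_rot (C5_rot C))).
have rev u w1 w2 w3 w4 w5 : u \in blow w1 w2 w3 w4 w5 -> u \in blow w3 w2 w1 w5 (w4 : G).
  by rewrite blow_rev.
have same w1 w2 w3 w4 w5 : C5 w1 w2 w3 w4 w5 -> nb y w1 -> nb y w3 -> nb z w1 ->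
    nb z w3 -> False.
  by move=> D a b c d; have := C5_common Gk D a b c d; rewrite yz.
have rim w1 w2 w3 w4 w5 u : u \in blow w1 w2 w3 w4 w5 -> nb u w1 /\ nb u (w3 : G).
  by rewrite inE => /and5P[].
have full (u : G) : pat v1 v2 v3 v4 v5 u true true true true true ->
  [/\ nb u v1, nb u v2, nb u v3, nb u v4 & nb u v5] by case=> *; split.
have D2 := C5_rot C; have D3 := C5_rot D2; have D4 := C5_rot D3.
case: (cap_boundary V pP yp yP) => [[yB|yB|yB|yB]|/full[y1 y2 y3 y4 y5]];
  case: (cap_boundary V qP zq zP) => [[zB|zB|zB|zB]|/full[z1 z2 z3 z4 z5]];
  try have [u1 u2] := rim _ _ _ _ _ _ yB;
  try have [t1 t2] := rim _ _ _ _ _ _ zB.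
- exact: (same _ _ _ _ _ C4).
- exact: (cap_12 V yz L yB zB).
- exact: (cap_13 V yz L yB zB).
- exact: (cap_15 V yz L yB zB).
- exact: (same _ _ _ _ _ C4).
- exact: (cap_12 V zy L' zB yB).
- exact: (same _ _ _ _ _ C).
- exact: (cap_15 V' yz M (rev _ _ _ _ _ _ yB) (rev _ _ _ _ _ _ zB)).
- exact: (cap_13 V' yz M (rev _ _ _ _ _ _ yB) (rev _ _ _ _ _ _ zB)).
- exact: (same _ _ _ _ _ C).
- exact: (cap_13 V zy L' zB yB).
- exact: (cap_15 V' zy M' (rev _ _ _ _ _ _ zB) (rev _ _ _ _ _ _ yB)).
- exact: (same _ _ _ _ _ D2).
- exact: (cap_35 V yz L yB zB).
- exact: (same _ _ _ _ _ D2).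
- exact: (cap_15 V zy L' zB yB).
- exact: (cap_13 V' zy M' (rev _ _ _ _ _ _ zB) (rev _ _ _ _ _ _ yB)).
- exact: (cap_35 V zy L' zB yB).
- exact: (same _ _ _ _ _ D4).
- exact: (same _ _ _ _ _ D4).
- exact: (same _ _ _ _ _ C4).
- exact: (same _ _ _ _ _ C).
- exact: (same _ _ _ _ _ D2).
- exact: (same _ _ _ _ _ D4).
- exact: (same _ _ _ _ _ C).
Qed.

(** By [conflict_EE] on both sides, the mere presence of [x] makes the edge [v1 v2] capped. For
    [no_T] this lemma then plays the part of the conflicts. *)
Lemma no_E v1 v2 v3 v4 v5 x : max_C5 v1 v2 v3 v4 v5 ->
  pat v1 v2 v3 v4 v5 x true true false false false -> False.
Proof.
move=> M px; have C := max_C5_C5 M; have [x1 x2 x3 x4 x5] := px.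
have px' : pat v2 v1 v5 v4 v3 x true true false false false by split.
suff V : capped v1 v2 v3 v4 v5.
  by have /setP/(_ x) := cap_empty V; rewrite !inE x3 x4 x5.
split=> // y [y1 y2 y3 y4 y5].
  by have := conflict_EE Gk y C px; rewrite y1 y2 y3 y4 y5.
by have := conflict_EE Gk y (C5_rev (C5_rot C)) px'; rewrite y1 y2 y3 y4 y5.
Qed.

Lemma no_T v1 v2 v3 v4 v5 x : max_C5 v1 v2 v3 v4 v5 ->
  pat v1 v2 v3 v4 v5 x true false false false false -> False.
Proof.
move=> M [x1 x2 x3 x4 x5]; suff V : capped v1 v2 v3 v4 v5.
  by have /setP/(_ x) := cap_empty V; rewrite !inE x3 x4 x5.
have M1 := max_C5_rot M; have M4 := max_C5_rot (max_C5_rot (max_C5_rot M1)).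
split=> // y [y1 y2 y3 y4 y5].
  by apply: (no_E (x := y) M1); split.
by apply: (no_E (x := y) M4); split.
Qed.

Lemma max_C5_cover v1 v2 v3 v4 v5 x : max_C5 v1 v2 v3 v4 v5 ->
  x \in ring v1 v2 v3 v4 v5 \/ pat v1 v2 v3 v4 v5 x true true true true true.
Proof.
move=> M1; have M2 := max_C5_rot M1; have M3 := max_C5_rot M2.
have M4 := max_C5_rot M3; have M5 := max_C5_rot M4.
have a1 := C5_arc Gk x (max_C5_C5 M1); have a2 := C5_arc Gk x (max_C5_C5 M2).
have a3 := C5_arc Gk x (max_C5_C5 M3); have a4 := C5_arc Gk x (max_C5_C5 M4).
have a5 := C5_arc Gk x (max_C5_C5 M5); have d := C5_dom Gk x (max_C5_C5 M1).
have t1 := fun px => no_T (x := x) M1 px; have t2 := fun px => no_T (x := x) M2 px.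
have t3 := fun px => no_T (x := x) M3 px; have t4 := fun px => no_T (x := x) M4 px.
have t5 := fun px => no_T (x := x) M5 px.
have e1 := fun px => no_E (x := x) M1 px; have e2 := fun px => no_E (x := x) M2 px.
have e3 := fun px => no_E (x := x) M3 px; have e4 := fun px => no_E (x := x) M4 px.
have e5 := fun px => no_E (x := x) M5 px.
rewrite !inE; move: a1 a2 a3 a4 a5 d t1 t2 t3 t4 t5 e1 e2 e3 e4 e5; rewrite /pat.
case: (nb x v1) (nb x v2) (nb x v3) (nb x v4) (nb x v5) => [] [] [] [] [] //=
  _ _ _ _ _ _ t1 t2 t3 t4 t5 e1 e2 e3 e4 e5; first [by left | by right | exfalso].
all: by [apply: t1 | apply: t2 | apply: t3 | apply: t4 | apply: t5
  | apply: e1 | apply: e2 | apply: e3 | apply: e4 | apply: e5].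
Qed.

End MaximalRing.

(** * Colouring a ring *)

Section Hyperhole.
Variable G : sgraph.
Implicit Types (k : nat) (x y : G) (X Y : {set G}).

Definition separated X Y := {in X & Y, forall x y, adj x y = false}.

Lemma separated_sym X Y : separated X Y -> separated Y X.
Proof. by move=> XY x y xY yX; rewrite adj_sym XY. Qed.

Let idx X x := index x (enum X).

Lemma idx_lt X x : x \in X -> idx X x < #|X|.
Proof. by move=> xX; rewrite cardE index_mem mem_enum. Qed.

Lemma idx_inj X x y : x \in X -> y \in X -> idx X x = idx X y -> x = y.
Proof.
move=> xX yX e; rewrite -(nth_index x (_ : x \in enum X)) ?mem_enum //.
by rewrite -/(idx X x) e nth_index ?mem_enum.
Qed.

(* [X1] and [X2] take the two ends of the colour range, [X3] the colours just
   below those of [X2], [X5] those just above [X1], and [X4] what remains. *)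
Lemma hyperhole_coloring k X1 X2 X3 X4 X5 :
    separated X1 X3 -> separated X2 X4 -> separated X3 X5 -> separated X4 X1 ->
    separated X5 X2 ->
    #|X1| + #|X2| <= k -> #|X2| + #|X3| <= k -> #|X3| + #|X4| <= k ->
    #|X4| + #|X5| <= k -> #|X5| + #|X1| <= k ->
    #|X1| + #|X2| + #|X3| + #|X4| + #|X5| <= 2 * k -> #|X4| <= #|X1| + #|X2| ->
  kcol k (X1 :|: X2 :|: X3 :|: X4 :|: X5).
Proof.
move=> s13 s24 s35 s41 s52.
have s31 := separated_sym s13; have s42 := separated_sym s24.
have s53 := separated_sym s35; have s14 := separated_sym s41.
have s25 := separated_sym s52.
have l1 := @idx_lt X1; have l2 := @idx_lt X2; have l3 := @idx_lt X3.
have l4 := @idx_lt X4; have l5 := @idx_lt X5.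
move: l1 l2 l3 l4 l5; set a1 := #|X1|; set a2 := #|X2|; set a3 := #|X3|.
set a4 := #|X4|; set a5 := #|X5| => l1 l2 l3 l4 l5 h12 h23 h34 h45 h51 hn h4.
(* The colours of [X3] and [X5] lie in the interval from [lo] to [hi - 1], which [X4] skips. The
   four possible values of [hi - lo] turn [a4 <= k - (hi - lo)] into the bounds on [a3 + a4], on
   [a4 + a5], on the total, and [a4 <= a1 + a2]. *)
pose lo := minn a1 (k - a2 - a3); pose hi := maxn (k - a2) (a1 + a5).
pose c x := if x \in X1 then idx X1 x
  else if x \in X2 then k - a2 + idx X2 x
  else if x \in X3 then k - a2 - a3 + idx X3 x
  else if x \in X5 then a1 + idx X5 x
  else if idx X4 x < lo then idx X4 x else idx X4 x + (hi - lo).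
have E x : x \in X1 :|: X2 :|: X3 :|: X4 :|: X5 ->
    [\/ x \in X1 /\ c x = idx X1 x, x \in X2 /\ c x = k - a2 + idx X2 x
      , x \in X3 /\ c x = k - a2 - a3 + idx X3 x
      | x \in X5 /\ c x = a1 + idx X5 x] \/
    x \in X4 /\ c x = if idx X4 x < lo then idx X4 x else idx X4 x + (hi - lo).
  rewrite !in_setU /c; case: (x \in X1) => /=; first by left; constructor 1.
  case: (x \in X2) => /=; first by left; constructor 2.
  case: (x \in X3) => /=; first by left; constructor 3.
  case: (x \in X5) => /=; first by left; constructor 4.
  by rewrite orbF; right.
exists c; split=> [x /E|x y /E Ex /E Ey xy exy].
  case=> [[[xX ->]|[xX ->]|[xX ->]|[xX ->]]|[xX ->]].
  - by move: (l1 x xX) h12; clear; lia.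
  - by move: (l2 x xX) h12; clear; lia.
  - by move: (l3 x xX) h23; clear; lia.
  - by move: (l5 x xX) h51; clear; lia.
  - by case: ifP; move: (l4 x xX) h12 h23 h34 h45 h51 hn h4; rewrite /lo /hi; clear; lia.
have ne X : x \in X -> y \in X -> idx X x <> idx X y.
  by move=> xX yX /(idx_inj xX yX) e; rewrite e adj_irrefl in xy.
move: exy.
case: Ex => [[[xX ->]|[xX ->]|[xX ->]|[xX ->]]|[xX ->]];
  case: Ey => [[[yX ->]|[yX ->]|[yX ->]|[yX ->]]|[yX ->]];
  try (by [rewrite s13 in xy|rewrite s31 in xy|rewrite s24 in xy|rewrite s42 in xy
          |rewrite s35 in xy|rewrite s53 in xy|rewrite s41 in xy|rewrite s14 in xy
          |rewrite s52 in xy|rewrite s25 in xy]).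
- exact: ne.
- by move: (l1 x xX) h12; clear; lia.
- by move: (l1 x xX); clear; lia.
- by move: (l1 y yX) h12; clear; lia.
- by move=> /addnI; apply: ne.
- by move: (l3 y yX) h23; clear; lia.
- by move: (l3 x xX) h23; clear; lia.
- by move=> /addnI; apply: ne.
- by case: ltnP; move: (l3 x xX) h23; rewrite /lo /hi; clear; lia.
- by move: (l1 y yX); clear; lia.
- by move=> /addnI; apply: ne.
- by case: ltnP; move: (l5 x xX); rewrite /lo /hi; clear; lia.
- by case: ltnP; move: (l3 y yX) h23; rewrite /lo /hi; clear; lia.
- by case: ltnP; move: (l5 y yX); rewrite /lo /hi; clear; lia.
- have := ne X4 xX yX; case: (ltnP (idx X4 x) lo); case: (ltnP (idx X4 y) lo);
    rewrite /lo /hi; move: (idx X4 x) (idx X4 y); clear; lia.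
Qed.

(** If [X4] is larger than [X1] and [X2] together, rotating [X3] to the front replaces the missing
    bound by [#|X1| <= #|X3| + #|X4|], which then holds. *)
Lemma hyperhole_kcol k X1 X2 X3 X4 X5 :
    separated X1 X3 -> separated X2 X4 -> separated X3 X5 -> separated X4 X1 ->
    separated X5 X2 ->
    #|X1| + #|X2| <= k -> #|X2| + #|X3| <= k -> #|X3| + #|X4| <= k ->
    #|X4| + #|X5| <= k -> #|X5| + #|X1| <= k ->
    #|X1| + #|X2| + #|X3| + #|X4| + #|X5| <= 2 * k ->
  kcol k (X1 :|: X2 :|: X3 :|: X4 :|: X5).
Proof.
move=> s13 s24 s35 s41 s52 h12 h23 h34 h45 h51 hn.
have [h4|h4] := leqP #|X4| (#|X1| + #|X2|); first exact: hyperhole_coloring.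
have -> : X1 :|: X2 :|: X3 :|: X4 :|: X5 = X3 :|: X4 :|: X5 :|: X1 :|: X2.
  by rewrite -!setUA [X1 :|: (X2 :|: _)]setUA [X1 :|: X2 :|: _]setUC -!setUA.
by apply: hyperhole_coloring => //; move: hn h4; clear; lia.
Qed.

End Hyperhole.

(** * Rings and universal vertices in a critical graph *)

Section RingColoring.
Variables (k : nat) (G : sgraph).
Hypotheses (Gk : critical k G) (k8 : 8 <= k).
Implicit Types (x y : G) (X Y : {set G}).

Lemma blow_separated v1 v2 v3 v4 v5 : C5 v1 v2 v3 v4 v5 ->
  separated (blow v5 v1 v2 v3 v4) (blow v2 v3 v4 v5 (v1 : G)).
Proof. by move=> C x y xB yB; apply/nb_false_adj/(blow_anti Gk C). Qed.

Lemma blow_mem v1 v2 v3 v4 v5 : C5 v1 v2 v3 v4 v5 -> (v1 : G) \in blow v5 v1 v2 v3 v4.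
Proof.
case=> e1 _ _ _ e5 n13 _ _ n41 _.
by rewrite inE e1 nb_refl n13 (nb_sym v1 v5) e5 (nb_sym v1 v4) n41.
Qed.

Lemma blow_triple v1 v2 v3 v4 v5 : C5 v1 v2 v3 v4 v5 ->
  #|blow v4 v5 v1 v2 v3| + #|blow v5 v1 v2 v3 v4| + #|blow v1 v2 v3 v4 (v5 : G)|
    <= k.+2.
Proof.
move=> C; apply: leq_trans (critical_degree Gk v1).
have d1 : [disjoint blow v4 v5 v1 v2 v3 & blow v5 v1 v2 v3 v4].
  rewrite disjoint_subset; apply/subsetP=> x; rewrite !inE => /and5P[_ _ _ /negbTE-> _].
  by rewrite !andbF.
have d2 : [disjoint blow v4 v5 v1 v2 v3 :|: blow v5 v1 v2 v3 v4 & blow v1 v2 v3 v4 v5].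
  rewrite disjoint_subset; apply/subsetP=> x; rewrite !inE.
  by case: (nb x v1) (nb x v2) (nb x v3) (nb x v4) (nb x v5) => [] [] [] [] [].
rewrite -[X in X + _ <= _](_ : #|blow v4 v5 v1 v2 v3 :|: blow v5 v1 v2 v3 v4| = _);
  last by rewrite cardsU disjoint_setI0 // cards0 subn0.
rewrite -[X in X <= _](_ : #|blow v4 v5 v1 v2 v3 :|: blow v5 v1 v2 v3 v4
  :|: blow v1 v2 v3 v4 v5| = _); last by rewrite cardsU disjoint_setI0 // cards0 subn0.
apply/subset_leq_card/subsetP=> x; rewrite !inE (nb_sym v1).
by case: (nb x v1) (nb x v2) (nb x v3) (nb x v4) (nb x v5) => [] [] [] [] [].
Qed.

Lemma extend_class X Y : kcol k.-1 X -> {in Y &, forall x y, adj x y = false} ->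
  kcol k (X :|: Y).
Proof.
case=> c [ck cP] YP; exists (fun x => if x \in Y then k.-1 else c x); split.
  move=> x; rewrite in_setU; case: ifP => [_ _|_]; first by move: k8; clear; lia.
  by rewrite orbF => /ck; move: k8; clear; lia.
move=> x y; rewrite !in_setU; case: ifP => xY; case: ifP => yY; rewrite ?orbT ?orbF.
- by move=> _ _; rewrite YP.
- by move=> _ /ck lt _ e; rewrite e ltnn in lt.
- by move=> /ck lt _ _ e; rewrite e ltnn in lt.
- exact: cP.
Qed.

(** If it failed, the degrees of [v1] and [v2] would leave one vertex each in the classes of [v5]
    and [v3], and [k + 1] in the two classes. By the clique bound these contain nonadjacent [x1] and
    [x2]; with [v4] they form a colour class, and the rest can be coloured with [k - 1] colours. *)
Lemma ring_pair_bound v1 v2 v3 v4 v5 : C5 v1 v2 v3 v4 v5 ->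
    ring v1 v2 v3 v4 v5 = [set: G] ->
  #|blow v5 v1 v2 v3 v4| + #|blow v1 v2 v3 v4 v5| <= k.
Proof.
move=> C1 R; rewrite leqNgt; apply/negP=> gt.
have C2 := C5_rot C1; have C3 := C5_rot C2; have C4 := C5_rot C3; have C5' := C5_rot C4.
have t1 := blow_triple C1; have t2 := blow_triple C2; have t3 := blow_triple C3.
have t4 := blow_triple C4; have t5 := blow_triple C5'.
have m1 := blow_mem C1; have m2 := blow_mem C2; have m3 := blow_mem C3.
have m4 := blow_mem C4; have m5 := blow_mem C5'.
have s13 := blow_separated C1; have s24 := blow_separated C2.
have s35 := blow_separated C3; have s41 := blow_separated C4.
have s52 := blow_separated C5'.
move: gt t1 t2 t3 t4 t5 m1 m2 m3 m4 m5 s13 s24 s35 s41 s52.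
have [cl1 cl2] := (blow_clique Gk C1, blow_clique Gk C2).
have sp2 x : x \in blow v1 v2 v3 v4 v5 -> nb x v1 /\ nb x v4 = false.
  by rewrite inE => /and5P[? _ _ /negbTE].
have sp1 x : x \in blow v5 v1 v2 v3 v4 -> nb x v2 /\ nb x v4 = false.
  by rewrite inE => /and5P[_ _ ? _ /negbTE].
move: cl1 cl2 sp1 sp2; rewrite /ring in R; move: R.
set X1 := blow v5 v1 v2 v3 v4; set X2 := blow v1 v2 v3 v4 v5.
set X3 := blow v2 v3 v4 v5 v1; set X4 := blow v3 v4 v5 v1 v2.
set X5 := blow v4 v5 v1 v2 v3 => R cl1 cl2 sp1 sp2 gt t1 t2 t3 t4 t5 m1 m2 m3 m4 m5.
move=> s13 s24 s35 s41 s52.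
have [x1 [x2 [x1X x2X n12]]] : exists x1 x2, [/\ x1 \in X1, x2 \in X2 & nb x1 x2 = false].
  have [/exists_inP[x1 x1X /exists_inP[x2 x2X n12]]|no] :=
      boolP [exists x1 in X1, [exists x2 in X2, ~~ nb x1 x2]].
    by exists x1, x2; split=> //; apply: negbTE.
  have X12 x y : x \in X1 -> y \in X2 -> nb x y.
    move=> xX yX; apply: contraT => n; case/negP: no.
    by apply/exists_inP; exists x => //; apply/exists_inP; exists y.
  have cl : nb_clique (X1 :|: X2).
    move=> x y /setUP[xX|xX] /setUP[yX|yX]; [exact: cl1 | exact: X12 | | exact: cl2].
    by rewrite nb_sym X12.
  have := critical_clique Gk cl; rewrite cardsU disjoint_setI0.
    by rewrite cards0; move: gt; clear; lia.
  rewrite disjoint_subset; apply/subsetP=> x; rewrite !inE.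
  by case: (nb x v1) (nb x v2) (nb x v3) (nb x v4) (nb x v5) => [] [] [] [] [].
have [x12 x14] := sp1 x1 x1X; have [x21 x24] := sp2 x2 x2X.
have p1 : 1 < #|X1|.
  rewrite (cardsD1 v1) m1 (cardsD1 x1) in_setD1 x1X andbT.
  by rewrite (_ : x1 != v1) //; apply: contraFneq n12 => ->; rewrite nb_sym.
have p2 : 1 < #|X2|.
  rewrite (cardsD1 v2) m2 (cardsD1 x2) in_setD1 x2X andbT.
  by rewrite (_ : x2 != v2) //; apply: contraFneq n12 => ->.
have p3 : 0 < #|X3| by apply/card_gt0P; exists v3.
have p4 : 0 < #|X4| by apply/card_gt0P; exists v4.
have p5 : 0 < #|X5| by apply/card_gt0P; exists v5.
have q1 := cardsD1 x1 X1; have q2 := cardsD1 x2 X2; have q4 := cardsD1 v4 X4.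
rewrite x1X in q1; rewrite x2X in q2; rewrite m4 in q4.
have sub (X Y X' Y' : {set G}) : X' \subset X -> Y' \subset Y ->
    separated X Y -> separated X' Y'.
  by move=> /subsetP XX /subsetP YY XY x y /XX xX /YY; apply: XY.
have col : kcol k.-1 (X1 :\ x1 :|: X2 :\ x2 :|: X3 :|: X4 :\ v4 :|: X5).
{ apply: hyperhole_kcol.
  - apply: (sub _ _ _ _ (subD1set _ _) (subxx _) s13).
  - apply: (sub _ _ _ _ (subD1set _ _) (subD1set _ _) s24).
  - exact: s35.
  - apply: (sub _ _ _ _ (subD1set _ _) (subD1set _ _) s41).
  - apply: (sub _ _ _ _ (subxx _) (subD1set _ _) s52).
  (* The remaining total is [k + #|X4|], and [#|X4| <= k - 4] because the larger of [X1] and [X2]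
     has at least five vertices. *)
  all: by move: k8 q1 q2 q4 p1 p2 p3 p4 p5 gt t1 t2 t3 t4 t5; clear; lia. }
have Yp : {in [set x1; x2; v4] &, forall x y, adj x y = false}.
  have [/nb_false_adj m12 /nb_false_adj m14 /nb_false_adj m24] := And3 n12 x14 x24.
  move=> x y; rewrite !in_setU !in_set1 -!orbA.
  by case/or3P=> /eqP-> /or3P[]/eqP->; rewrite ?adj_irrefl // adj_sym.
case: (critical_not_kcol Gk); have [c cP] := extend_class col Yp.
exists c; apply: proper_onS cP; rewrite -R; apply/subsetP=> x.
rewrite !(in_setU, in_setD1, in_set1).
case: (x =P x1) => [->|_]; first by rewrite !orbT.
case: (x =P x2) => [->|_]; first by rewrite !orbT.
case: (x =P v4) => [->|_]; first by rewrite !orbT.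
by rewrite /= !orbF.
Qed.

Theorem critical_false : False.
Proof.
have [v1 [v2 [v3 [v4 [v5 M]]]]] := max_C5_exists Gk; have C1 := max_C5_C5 M.
have noU x : ~ pat v1 v2 v3 v4 v5 x true true true true true.
  move=> [x1 x2 x3 x4 x5].
  have C2 := C5_rot C1; have C3 := C5_rot C2; have C4 := C5_rot C3; have D := C5_rot C4.
  have univ y : nb x y.
    rewrite nb_sym; case: (max_C5_cover Gk k8 y M) => [/in_ring[[yB|yB|yB]|[yB|yB]]|[? ? ? ? ?]];
      try (move: yB; rewrite inE => /and5P[? _ ? _ _]).
    - exact: (C5_common Gk D).
    - exact: (C5_common Gk C1).
    - exact: (C5_common Gk C2).
    - exact: (C5_common Gk C3).
    - exact: (C5_common Gk C4).
    - exact: (C5_common Gk C1).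
  have Gcard : #|[set: G]| <= k.+2.
    apply: leq_trans (critical_degree Gk x); apply/subset_leq_card/subsetP=> y _.
    by rewrite inE.
  have [e12 e23 e34 e45 e51 n13 n24 n35 n41 n52] := C1.
  have ne (u v w : G) : nb u w -> nb v w = false -> u != v.
    by move=> uw vw; apply: contraTneq uw => ->; rewrite vw.
  have d13 := nb_false_neq n13; have d24 := nb_false_neq n24.
  have d34 : v3 != v4 by rewrite eq_sym (ne v4 v3 v5).
  have d23 : v2 != v3 by rewrite (ne v2 v3 v1) // nb_sym.
  have d14 : v1 != v4 by rewrite eq_sym nb_false_neq.
  pose r y := if y == v3 then v1 else if y == v4 then v2 else y.
  case: (critical_not_kcol Gk).
  apply: (@card_kcol G k setT (setT :\ v3 :\ v4) r).
  - move: Gcard; rewrite (cardsD1 v3) inE (cardsD1 v4) in_setD1 inE eq_sym d34.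
    by clear; lia.
  - move=> y _; rewrite /r !in_setD1 in_setT andbT.
    case: (altP (y =P v3)) => [_|y3]; first by rewrite d14 d13.
    by case: (altP (y =P v4)) => [_|y4]; rewrite ?d24 ?d23 ?y4 ?y3.
  - have [/nb_false_adj m13 /nb_false_adj m24] := conj n13 n24.
    have d12 : v1 != v2 by rewrite eq_sym (ne v2 v1 v3) // nb_sym.
    have rE y z : r y = r z ->
        [\/ y = z, (y \in [:: v1; v3]) && (z \in [:: v1; v3])
          | (y \in [:: v2; v4]) && (z \in [:: v2; v4])].
      rewrite /r !inE.
      case: (altP (y =P v3)) => [->|y3]; case: (altP (z =P v3)) => [->|z3];
        rewrite ?eqxx ?orbT /=; try by constructor 1.
      - case: (altP (z =P v4)) => [_ e|_ <-]; first by rewrite e eqxx in d12.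
        by rewrite eqxx; constructor 2.
      - case: (altP (y =P v4)) => [_ e|_ ->]; first by rewrite e eqxx in d12.
        by rewrite eqxx; constructor 2.
      case: (altP (y =P v4)) => [->|y4]; case: (altP (z =P v4)) => [->|z4].
      - by constructor 1.
      - by move=> <-; rewrite !eqxx !orbT; constructor 3.
      - by move=> ->; rewrite !eqxx !orbT; constructor 3.
      - by constructor 1.
    move=> y z _ _ /rE[->||]; rewrite ?adj_irrefl // !inE;
      by move=> /andP[/orP[]/eqP-> /orP[]/eqP->]; rewrite ?adj_irrefl // adj_sym.
have R : ring v1 v2 v3 v4 v5 = [set: G].
  by apply/setP=> x; rewrite in_setT; case: (max_C5_cover Gk k8 x M) => [->|/noU].
have C2 := C5_rot C1; have C3 := C5_rot C2; have C4 := C5_rot C3; have D := C5_rot C4.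
have R2 := R; rewrite -ring_rot in R2; have R3 := R2; rewrite -ring_rot in R3.
have R4 := R3; rewrite -ring_rot in R4; have R5 := R4; rewrite -ring_rot in R5.
have := ring_pair_bound C1 R; have := ring_pair_bound C2 R2.
have := ring_pair_bound C3 R3; have := ring_pair_bound C4 R4.
have := ring_pair_bound D R5; have := blow_triple C1; have := blow_triple C2.
have := blow_triple C3; have := blow_triple C4; have := blow_triple D.
move=> t5 t4 t3 t2 t1 p5 p4 p3 p2 p1; case: (critical_not_kcol Gk); rewrite -R /ring.
have s13 := blow_separated C1; have s24 := blow_separated C2.
have s35 := blow_separated C3; have s41 := blow_separated C4.
have s52 := blow_separated D.
by apply: hyperhole_kcol => //; move: k8 t1 t2 t3 t4 t5; clear; lia.
Qed.

End RingColoring.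

(** * Reduction to critical graphs *)

Lemma nb_induced (G : sgraph) (A : {set G}) (u v : induced A) :
  nb (val u) (val v) = nb u v.
Proof. by rewrite /nb val_eqE. Qed.

Lemma sparse_colorable k : 8 <= k -> forall G : sgraph,
    noC4 G -> noC6 G -> noP6 G -> (forall x : G, #|[set y | nb x y]| <= k.+2) ->
    (forall A : {set G}, nb_clique A -> #|A| <= k) ->
  colorable G k.
Proof.
move=> k8 G; have [n] := ubnP #|G|; elim: n G => // n IH G Gn h4 h6 hP hdeg hcl.
apply: contraT => nG; exfalso; apply: (@critical_false k G _ k8); split=> //; last first.
  by move=> /kcol_colorable; apply/negP.
move=> A AT; have : colorable (induced A) k.
  apply: IH.
  - rewrite card_sig; apply: (@leq_trans #|G|); last by rewrite -ltnS.
    by rewrite -cardsT; apply: proper_card; rewrite properT.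
  - by move=> a b c d; rewrite -!nb_induced; apply: h4.
  - by move=> a b c d e f; rewrite -!nb_induced; apply: h6.
  - by move=> a b c d e f; rewrite -!nb_induced; apply: hP.
  - move=> x; apply: leq_trans (hdeg (val x)); rewrite -(card_imset _ val_inj).
    apply/subset_leq_card/subsetP=> _ /imsetP[y + ->].
    by rewrite !inE -nb_induced.
  - move=> X Xcl; rewrite -(card_imset _ val_inj); apply: hcl.
    by move=> _ _ /imsetP[x xX ->] /imsetP[y yX ->]; rewrite nb_induced Xcl.
case/existsP=> c /forallP cP.
exists (fun x => if insub x is Some u then val (c u) else 0); split=> [x xA|x y xA yA xy].
  by rewrite insubT ltn_ord.
rewrite !insubT => /val_inj e.
have /forallP/(_ (Sub y yA))/implyP/(_ xy) := cP (Sub x xA).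
by rewrite e eqxx.
Qed.

Theorem theorem1p4 (G : sgraph)
    (hfree : free [:: path_graph 6; cycle_graph 4; cycle_graph 6] G)
    (hDelta : 9 <= max_degree G)
    (homega : clique_number G <= max_degree G - 1) :
  chromatic_number G <= max_degree G - 1.
Proof.
have col : colorable G (max_degree G - 1).
  apply: sparse_colorable; first by lia.
  - by apply: free_noC4 hfree; right; left.
  - by apply: free_noC6 hfree; right; right; left.
  - by apply: free_noP6 hfree; left.
  - move=> x; apply: (@leq_trans (degree x).+1).
      rewrite (cardsD1 x) inE nb_refl ltnS; apply/subset_leq_card/subsetP=> y.
      by rewrite !inE adjE eq_sym andbC.
    have : degree x <= max_degree G by exact: leq_bigmax_cond.
    by move: hDelta; clear; lia.
  move=> A /nb_cliqueE cA; apply: leq_trans homega.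
  exact: (@leq_bigmax_cond _ _ (fun A : {set G} => #|A|)).
by rewrite /chromatic_number; case: ex_minnP => m _; apply.
Qed.
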